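(* Let $\mathbb{V}$ be a game mapping that satisfies the discrete dynamic programming principle on $\mathfrak{D}$, let $\mathcal{V}[\varrho]:=\mathbb{V}\big[c[\varrho]\big]$ for $\varrho\in\mathfrak{D}$, let $U_*:\Omega\to[0,1]$ be arbitrary, and suppose $z(n+s)=z(n)$ for all $z\in\mathbb{K}$, $n\in\mathbb{N}\cup\{0\}$, $s\in(0,1)$. Then each of the following conditions (c), (u), (e), (p), (q) is equivalent to the condition (u') $\lim_{n\to\infty,\,n\in\mathbb{N}}\sup_{\omega\in\Omega}\big|\mathcal{V}[\varpi_n](\omega)-U_*(\omega)\big|=0$. Conditions: (c) for every density $\mu\in\mathfrak{D}$ piecewise continuous on $(0,\infty)$, $\lim_{\lambda\to+0}\sup_{\omega}|\mathcal{V}[\mu^\lambda_{\mathrm{scale}}](\omega)-U_*(\omega)|=0$; (u) $\lim_{T\to+\infty}\sup_\omega|\mathcal{V}[\varpi_T](\omega)-U_*(\omega)|=0$; (e) $\lim_{\lambda\to+0}\sup_\omega|\mathcal{V}[\pi_\lambda](\omega)-U_*(\omega)|=0$; (p) for some power density $\varrho\in\mathfrak{D}$, $\lim_{T\to+\infty}\sup_\omega|\mathcal{V}[\varrho^T_{\mathrm{shift}}](\omega)-U_*(\omega)|=0$; (q) the same limit holds for every power density $\varrho\in\mathfrak{D}$.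
   Context: $\mathbb{R}_+=[0,\infty)$. Fix a nonempty set $\Omega$, a nonempty set $\mathbb{K}$ of maps $\mathbb{R}_+\to\Omega$, and $g:\Omega\to[0,1]$ with $t\mapsto g(z(t))$ Lebesgue measurable for each $z\in\mathbb{K}$. $\mathfrak{C}$: bounded maps $\mathbb{K}\to\mathbb{R}$; $\mathfrak{U}$: bounded maps $\Omega\to\mathbb{R}$. A game mapping is $\mathbb{V}:\mathfrak{C}\to\mathfrak{U}$ with $\mathbb{V}[Ac+B]=A\mathbb{V}[c]+B$ ($A\ge0$, $B\in\mathbb{R}$) and monotone ($c_1\le c_2$ pointwise on $\mathbb{K}$ implies $\mathbb{V}[c_1]\le\mathbb{V}[c_2]$ pointwise on $\Omega$). $\mathfrak{D}$: probability densities $\varrho:\mathbb{R}_+\to\mathbb{R}_+$. For $\varrho\in\mathfrak{D}$, $T>0$ with $\int_T^\infty\varrho>0$: $\varrho^T_{\mathrm{shift}}(t)=\varrho(t+T)/\int_T^\infty\varrho$; for $\lambda>0$: $\varrho^\lambda_{\mathrm{scale}}(t)=\lambda\varrho(\lambda t)$. $c[\varrho](z)=\int_0^\infty\varrho(t)g(z(t))dt$. For such $\varrho,T$: $d[\varrho,T](z)=\int_0^T\varrho(t)g(z(t))dt+\int_T^\infty\varrho\cdot\mathbb{V}[c[\varrho^T_{\mathrm{shift}}]](z(T))$. $\mathbb{V}$ satisfies the discrete dynamic programming principle on $\mathfrak{D}$ if $\mathbb{V}[d[\varrho,n]]=\mathbb{V}[c[\varrho]]$ for all $\varrho\in\mathfrak{D}$,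 $n\in\mathbb{N}$ with $\int_n^\infty\varrho>0$. $\varpi_T(t)=\frac1T1_{[0,T]}(t)$, $\pi_\lambda(t)=\lambda e^{-\lambda t}$. A power density is $\varrho\in\mathfrak{D}$ of the form $\varrho(t)=(\alpha+\beta t)^{-\gamma}$ with $\alpha,\beta,\gamma>0$. *)

(* Defs.v *)
From mathcomp Require Import all_boot all_order all_algebra.
From mathcomp Require Import all_classical all_reals all_analysis.
Set Implicit Arguments. Unset Strict Implicit. Unset Printing Implicit Defensive.
Import Order.TTheory GRing.Theory Num.Theory.
Import numFieldNormedType.Exports.
Local Open Scope classical_set_scope.
Local Open Scope ring_scope.

Section Defs.
Variable R : realType.

(* R with the (completed) Lebesgue sigma-algebra *)
Definition LR : measurableType _ :=
  caratheodory_type (R:=R) (@lebesgue_measure R)^*%mu.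

Definition lmeas (D : set R) (f : R -> R) : Prop :=
  measurable_fun (D : set LR) (f : LR -> R).

Definition lint (D : set R) (f : R -> R) : \bar R :=
  (\int[completed_lebesgue_measure]_(t in (D : set LR)) (f t)%:E)%E.

Definition Rp : set R := `[0, +oo[.

(* rho is a probability density on R_+ (values on t < 0 are irrelevant) *)
Definition is_density (rho : R -> R) : Prop :=
  [/\ forall t, 0 <= t -> 0 <= rho t, lmeas Rp rho & lint Rp rho = 1%E].

Definition tailmass (rho : R -> R) (T : R) : R := fine (lint `[T, +oo[ rho).

Definition shift_dens (rho : R -> R) (T : R) : R -> R :=
  fun t => rho (t + T) / tailmass rho T.

Definition scale_dens (rho : R -> R) (lam : R) : R -> R :=
  fun t => lam * rho (lam * t).

Definition unifd (T : R) : R -> R :=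
  fun t => if (0 <= t) && (t <= T) then T^-1 else 0.

Definition expd (lam : R) : R -> R := fun t => lam * expR (- (lam * t)).

Definition power_density (rho : R -> R) : Prop :=
  is_density rho /\
  exists a b c : R, [/\ 0 < a, 0 < b, 0 < c &
    forall t, 0 <= t -> rho t = (a + b * t) `^ (- c)].

Definition pw_continuous (mu : R -> R) : Prop :=
  forall a b : R, 0 < a -> a < b ->
    exists s : seq R,
      (forall x, a <= x <= b -> x \notin s -> {for x, continuous mu}) /\
      (forall x, x \in s -> cvg (mu @ at_left x) /\ cvg (mu @ at_right x)).

Variable Omega : Type.

Definition bounded_on (K : set (R -> Omega)) (c : (R -> Omega) -> R) : Prop :=
  exists M : R, forall z, K z -> `|c z| <= M.

Definition game_mapping (K : set (R -> Omega))
    (V : ((R -> Omega) -> R) -> Omega -> R) : Prop :=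
  [/\ (forall c, bounded_on K c -> exists M : R, forall w, `|V c w| <= M),
      (forall c (A B : R), bounded_on K c -> 0 <= A ->
          V (fun z => A * c z + B) = (fun w => A * V c w + B)) &
      (forall c1 c2, bounded_on K c1 -> bounded_on K c2 ->
          (forall z, K z -> c1 z <= c2 z) -> forall w, V c1 w <= V c2 w)].

Definition cost (g : Omega -> R) (rho : R -> R) : (R -> Omega) -> R :=
  fun z => fine (lint Rp (fun t => rho t * g (z t))).

Definition dcost (g : Omega -> R) (V : ((R -> Omega) -> R) -> Omega -> R)
    (rho : R -> R) (T : R) : (R -> Omega) -> R :=
  fun z => fine (lint `[0, T] (fun t => rho t * g (z t)))
           + tailmass rho T * V (cost g (shift_dens rho T)) (z T).

Definition discrete_DPP (g : Omega -> R) (V : ((R -> Omega) -> R) -> Omega -> R)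
  : Prop :=
  forall rho, is_density rho -> forall n : nat, (0 < n)%N ->
    (0 < lint `[n%:R, +oo[ rho)%E ->
    V (dcost g V rho n%:R) = V (cost g rho).

Definition dev (F U : Omega -> R) : \bar R :=
  ereal_sup [set (`|F w - U w|)%:E | w in [set: Omega]].

End Defs.
Arguments Rp {R}.
Arguments LR {R}.

(* Main.v *)
Require Import Defs.
From mathcomp Require Import all_boot all_order all_algebra.
From mathcomp Require Import all_classical all_reals all_analysis.
From mathcomp Require Import measurable_realfun.
From mathcomp Require Import ring lra.
Set Implicit Arguments. Unset Strict Implicit. Unset Printing Implicit Defensive.
Import Order.TTheory GRing.Theory Num.Theory.
Import numFieldNormedType.Exports.
Local Open Scope classical_set_scope.
Local Open Scope ring_scope.

(** Since trajectories are constant on each [[n, n+1)], only the cell masses [p_k] of a density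
    matter, and the principle reads [J(p) = V(sum_(k < n) p_k g(z_k) + J(shift^n p)(z_n))] with
    [J(p) = V(sum_k p_k g(z_k))].  Write [E_n(C)] for the value of [n] stages of weight [1] followed
    by the terminal reward [C U].

    If the Cesaro values converge to [U], comparing with [J] of [n + C] unit weights gives
    [E_n(C) = (n + C) U + o(n + C)].  By homogeneity a block of constant weights followed by
    something close to [T U] is again close to (total mass) [U]; a piecewise continuous density is
    nearly constant on finitely many blocks, hence all its scalings have values close to [U].

    Conversely, the exponential and the power densities are self-similar: a shift of a scaling is a
    scaling.  If the values of the scalings converge to [U], dynamic programming therefore gives
    [E_n(C) = (n + C) U] up to [O(n^2 / C) + o(C)], and cutting a long run of unit weights into
    blocks with [n / C] small recovers the Cesaro limit. *)

(** * Integration for the completed Lebesgue measure *)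

(** The two directions meet different obstacles. From Cesaro values to a general density, the number
    of blocks depends on the density and on the accuracy, so the errors have to add up independently
    of it: a block costs twice its L1 distance to a constant height, plus a term [h A] that fine
    scalings make negligible because [A] is fixed before the scale. Near time 0, where the density
    may be unbounded, nothing is approximated and the small mass is paid in full.

    In the other direction about [1 / kappa] blocks are chained, so an error of order [kappa] per
    block would be useless. Taking the values of the scalings within [kappa^2] of [U] and keeping
    [n <= kappa C] makes both sources of error in a block of order [kappa^2 C].

    The principle is assumed for probability densities only, so finite weight sequences are turned
    into densities constant on unit cells. Densities are merely Lebesgue measurable, so changes of
    variable are proved on Caratheodory sets. *)

Section LebesgueIntegral.
Variable R : realType.
Local Notation cmu := (@completed_lebesgue_measure R).
Local Notation lmu := (@lebesgue_measure R).
Local Notation wl := (@wlength R idfun).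

(* [LR] is built from the outer measure extending [lebesgue_measure], whereas
   [completed_lebesgue_measure] lives on the Caratheodory sets of the one extending interval
   lengths; the two sigma-algebras coincide but are not convertible. *)
Definition CR : measurableType _ := caratheodory_type (wl^*)%mu.

(** A cover by half-open intervals is a cover by measurable sets of the same measures. Conversely,
    on measurable sets [lmu] is the outer measure of the right-hand side, so countable subadditivity
    bounds it along any measurable cover. *)
Lemma mu_ext_lebesgueE : (lmu^*)%mu = (wl^*)%mu :> (set R -> \bar R).
Proof.
apply/funext => X; apply/eqP; rewrite eq_le; apply/andP; split.
  apply: le_ereal_inf_tmp => _ [A [mA XA] <-].
  apply: ereal_inf_lbound; exists A.
    by split => // i; exact: sub_sigma_algebra (mA i).
  by apply: eq_eseriesr => i _; rewrite /= [LHS]measurable_mu_extE.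
apply: le_ereal_inf_tmp => _ [A [mA XA] <-].
apply: (@le_trans _ _ (lmu (\bigcup_k A k))); first exact: le_mu_ext.
exact: (outer_measure_sigma_subadditive (wl^*)%mu A).
Qed.

Lemma measurable_LR (A : set R) :
  measurable (A : set LR) <-> measurable (A : set CR).
Proof.
by rewrite /measurable /=; split; rewrite /caratheodory_measurable mu_ext_lebesgueE.
Qed.

Lemma lmeasE (D : set R) (f : R -> R) :
  lmeas D f <-> measurable_fun (D : set CR) (f : CR -> R).
Proof.
split => mf mD Y mY; apply/measurable_LR; apply: mf => //; exact/measurable_LR.
Qed.

Lemma measurable_CR (A : set R) : measurable A -> measurable (A : set CR).
Proof. by move=> mA; apply: sub_caratheodory. Qed.

Section affine.
Variables (l b : R).
Hypothesis l0 : 0 < l.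
Let phi (x : R) := l * x + b.

Lemma ocitv_affine_preimage (A : set R) : ocitv A ->
  ocitv (phi @^-1` A) /\ wl (phi @^-1` A) = (l^-1%:E * wl A)%E.
Proof.
move=> [[u v]] /= uv <-.
have -> : phi @^-1` `]u, v]%classic = `](u - b) / l, (v - b) / l]%classic.
  apply/seteqP; split => x /=; rewrite !in_itv/= /phi.
    by rewrite ltr_pdivrMr// ler_pdivlMr// mulrC ltrBlDr lerBrDr.
  by rewrite ltr_pdivrMr// ler_pdivlMr// mulrC ltrBlDr lerBrDr.
split; first exact: is_ocitv.
have E : ((u - b) / l < (v - b) / l) = (u < v) by rewrite ltr_pM2r ?invr_gt0// ltrD2r.
rewrite !wlength_itv/= !lte_fin E; case: ifP => _; last by rewrite mule0.
rewrite /= -EFinB -EFinB -EFinM; congr EFin.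
by field; rewrite gt_eqF.
Qed.

(** Covers by half-open intervals pull back to such covers, with lengths divided by [l]. Applying
    this to the inverse affine map turns the inequality into the equality [mu_ext_affine]. *)
Lemma mu_ext_affine_le (Y : set R) :
  ((wl^*)%mu (phi @^-1` Y) <= l^-1%:E * (wl^*)%mu Y)%E.
Proof.
have l1 : (0 < l^-1%:E)%E by rewrite lte_fin invr_gt0.
rewrite muleC -lee_pdivrMr ?invr_gt0// muleC.
apply: le_ereal_inf_tmp => _ [A [mA YA] <-].
rewrite muleC lee_pdivrMr ?invr_gt0// muleC.
rewrite -nneseriesZl//.
apply: ereal_inf_lbound; exists (fun k => phi @^-1` A k).
  split; first by move=> i; exact: (ocitv_affine_preimage (mA i)).1.
  by rewrite -preimage_bigcup; exact: preimage_subset.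
by apply: eq_eseriesr => i _; exact: (ocitv_affine_preimage (mA i)).2.
Qed.
End affine.

Lemma mu_ext_affine (l b : R) (Y : set R) : 0 < l ->
  ((wl^*)%mu ((fun x => l * x + b)%R @^-1` Y) = l^-1%:E * (wl^*)%mu Y)%E.
Proof.
move=> l0; apply/eqP; rewrite eq_le mu_ext_affine_le//=.
have li : 0 < l^-1 by rewrite invr_gt0.
have := mu_ext_affine_le (- (b / l)) li ((fun x => l * x + b) @^-1` Y).
rewrite invrK -comp_preimage (_ : _ \o _ = id); last first.
  by apply/funext => x /=; field; rewrite gt_eqF.
by rewrite preimage_id lee_pdivrMl.
Qed.

(** Continuity would only handle Borel sets. Here the Caratheodory criterion itself is transported:
    each test set is the preimage of some [W], and all three outer measures are divided by the same
    [l]. *)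
Lemma measurable_affine (l b : R) : 0 < l ->
  measurable_fun setT ((fun x => l * x + b) : CR -> CR).
Proof.
move=> l0 _ Y mY; rewrite setTI.
have li : 0 < l^-1 by rewrite invr_gt0.
move=> X.
have E (Z : set R) : Z = (fun x => l * x + b) @^-1` ((fun x => l^-1 * x + (- (b / l))) @^-1` Z).
  rewrite -comp_preimage (_ : _ \o _ = id) ?preimage_id//.
  by apply/funext => x /=; field; rewrite gt_eqF.
rewrite (E X) preimage_setC -!preimage_setI.
set W := _ @^-1` X.
have M Z := mu_ext_affine b Z l0.
apply: (etrans (M W)); have -> : (wl^*)%mu W = ((wl^*)%mu (W `&` Y) + (wl^*)%mu (W `&` ~` Y))%E := mY W.
rewrite ge0_muleDr; try exact: outer_measure_ge0.
by congr (_ + _)%E; apply/esym; exact: M.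
Qed.

(** The pushforward of the measure under the affine map is [l^-1] times the measure. *)
Lemma lint_affine (l b : R) (D : set R) (f : R -> R) : 0 < l ->
  measurable D -> lmeas D f -> (forall x, D x -> 0 <= f x) ->
  lint ((fun x => l * x + b) @^-1` D) (fun x => f (l * x + b)) = (l^-1%:E * lint D f)%E.
Proof.
move=> l0 mD /lmeasE mf f0.
pose phi : CR -> CR := fun x => l * x + b.
have mphi : measurable_fun setT phi := measurable_affine b l0.
have mDC := measurable_CR mD.
transitivity (\int[pushforward cmu phi]_(y in (D : set CR)) (f y)%:E)%E.
  rewrite ge0_integral_pushforward//; first exact/measurable_EFinP.
  by move=> y; rewrite inE => Dy; rewrite lee_fin f0.
have li : 0 <= l^-1 by rewrite invr_ge0 ltW.
transitivity (\int[mscale (NngNum li) cmu]_(y in (D : set CR)) (f y)%:E)%E.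
  apply: eq_measure_integral => A mA _.
  rewrite /pushforward /mscale /=; exact: mu_ext_affine.
rewrite ge0_integral_mscale//; first exact/measurable_EFinP.
Qed.

Lemma lmeas_affine (l b : R) (D : set R) (f : R -> R) : 0 < l ->
  measurable D -> lmeas D f ->
  lmeas ((fun x => l * x + b) @^-1` D) (fun x => f (l * x + b)).
Proof.
move=> l0 mD /lmeasE mf; apply/lmeasE => _ Y mY.
have := mf (measurable_CR mD) Y mY => /(measurable_affine b l0 measurableT).
by rewrite setTI preimage_setI.
Qed.

(** The identity from the completed to the Borel structure is measurable and pushes the completed
    measure to [lmu]. This gives access to the known integrals of explicit densities. *)
Lemma lint_lebesgue (D : set R) (f : R -> R) :
  measurable D -> measurable_fun D f -> (forall x, D x -> 0 <= f x) ->
  lint D f = (\int[lmu]_(x in D) (f x)%:E)%E.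
Proof.
move=> mD mf f0.
have mid : measurable_fun setT (idfun : CR -> measurableTypeR R).
  by move=> _ Y mY; rewrite setTI; exact: measurable_CR.
transitivity (\int[pushforward cmu (idfun : CR -> measurableTypeR R)]_(y in D) (f y)%:E)%E.
  rewrite ge0_integral_pushforward//; first exact/measurable_EFinP.
  by move=> y; rewrite inE => Dy; rewrite lee_fin f0.
by apply: eq_measure_integral => A mA _.
Qed.

Lemma lmeas_borel (D : set R) (f : R -> R) : measurable D -> measurable_fun D f -> lmeas D f.
Proof.
by move=> mD mf; apply/lmeasE => _ Y mY; apply: measurable_CR; apply: mf.
Qed.

Lemma lmeasM (D : set R) (f g : R -> R) : lmeas D f -> lmeas D g -> lmeas D (fun x => f x * g x).
Proof. by move=> /lmeasE mf /lmeasE mg; apply/lmeasE; exact: measurable_funM. Qed.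

Lemma lmeasS (D E : set R) (f : R -> R) : measurable E -> D `<=` E -> lmeas E f -> lmeas D f.
Proof. by move=> /measurable_CR mE DE /lmeasE mf; apply/lmeasE; exact: measurable_funS mf. Qed.

Lemma eq_lmeas (D : set R) (f g : R -> R) : (forall x, D x -> f x = g x) -> lmeas D f -> lmeas D g.
Proof.
move=> fg /lmeasE mf; apply/lmeasE; apply: eq_measurable_fun mf => x /[!inE]; exact: fg.
Qed.

Lemma eq_lint (D : set R) (f g : R -> R) : (forall x, D x -> f x = g x) -> lint D f = lint D g.
Proof. by move=> fg; apply: eq_integral => x /[!inE] Dx; rewrite fg. Qed.

Lemma lint_ge0 (D : set R) (f : R -> R) : (forall x, D x -> 0 <= f x) -> (0 <= lint D f)%E.
Proof. by move=> f0; apply: integral_ge0 => x Dx; rewrite lee_fin f0. Qed.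

Lemma le_lint (D : set R) (f g : R -> R) : measurable D -> lmeas D f -> lmeas D g ->
  (forall x, D x -> 0 <= f x) -> (forall x, D x -> f x <= g x) -> (lint D f <= lint D g)%E.
Proof.
move=> /measurable_CR mD /lmeasE mf /lmeasE mg f0 fg; apply: ge0_le_integral.
- exact: mD.
- by move=> x Dx; rewrite lee_fin f0.
- exact/measurable_EFinP.
- exact/measurable_EFinP.
- by move=> x Dx; rewrite lee_fin fg.
Qed.

Lemma lintZl (D : set R) (k : R) (f : R -> R) : measurable D -> lmeas D f ->
  (forall x, D x -> 0 <= f x) -> 0 <= k -> lint D (fun x => k * f x) = (k%:E * lint D f)%E.
Proof.
move=> /measurable_CR mD /lmeasE mf f0 k0; rewrite /lint.
under eq_integral do rewrite EFinM.
rewrite ge0_integralZl_EFin//; first exact/measurable_EFinP.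
Qed.

Lemma lint_setU (A B : set R) (f : R -> R) : measurable A -> measurable B ->
  lmeas (A `|` B) f -> (forall x, (A `|` B) x -> 0 <= f x) -> [disjoint A & B] ->
  lint (A `|` B) f = (lint A f + lint B f)%E.
Proof.
move=> /measurable_CR mA /measurable_CR mB /lmeasE mf f0 AB.
apply: ge0_integral_setU => //; first exact/measurable_EFinP.
Qed.

Lemma lint_subset (A B : set R) (f : R -> R) : measurable A -> measurable B ->
  lmeas B f -> (forall x, B x -> 0 <= f x) -> A `<=` B -> (lint A f <= lint B f)%E.
Proof.
move=> /measurable_CR mA /measurable_CR mB /lmeasE mf f0 AB.
apply: ge0_subset_integral => //; first exact/measurable_EFinP.
Qed.

Lemma lint_cst (i : interval R) (c : R) : lint [set` i] (fun=> c) = (c%:E * lmu [set` i])%E.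
Proof. by apply: integral_cst; apply: measurable_CR. Qed.

End LebesgueIntegral.

(** * Masses of intervals, scalings and shifts of densities *)

Section Mass.
Variable R : realType.
Implicit Types (rho f : R -> R) (a b c x y : R).

Definition mass rho a b : R := fine (lint `[a, b[ rho).

Section density.
Variable rho : R -> R.
Hypothesis rhoD : is_density rho.

Let rho0 t : 0 <= t -> 0 <= rho t. Proof. by case: rhoD => + _ _; exact. Qed.

Lemma lmeas_density (D : set R) : D `<=` Rp -> lmeas D rho.
Proof. by case: rhoD => _ m _ /lmeasS; apply => //; exact: measurable_itv. Qed.

Lemma lint_density_fin (D : set R) : measurable D -> D `<=` Rp ->
  lint D rho \is a fin_num.
Proof.
case: rhoD => r0 m r1 mD D0; rewrite ge0_fin_numE; last first.
  by apply: lint_ge0 => x /D0; rewrite /Rp/= in_itv/= andbT; exact: r0.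
apply: (@le_lt_trans _ _ (lint Rp rho)); last by rewrite r1 ltry.
apply: lint_subset => //; first exact: measurable_itv.
by move=> x; rewrite /Rp/= in_itv/= andbT; exact: r0.
Qed.

Lemma sub_Rp a b : 0 <= a -> `[a, b[ `<=` @Rp R.
Proof. by move=> a0 x; rewrite /Rp/= !in_itv/= andbT => /andP[/(le_trans a0)]. Qed.

Lemma sub_Rpy a : 0 <= a -> `[a, +oo[ `<=` @Rp R.
Proof. by move=> a0 x; rewrite /Rp/= !in_itv/= !andbT => /(le_trans a0). Qed.

Lemma massE a b : 0 <= a -> lint `[a, b[ rho = (mass rho a b)%:E.
Proof.
move=> a0; rewrite /mass fineK//; apply: lint_density_fin; first exact: measurable_itv.
exact: sub_Rp.
Qed.

Lemma tailmassE a : 0 <= a -> lint `[a, +oo[ rho = (tailmass rho a)%:E.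
Proof.
move=> a0; rewrite /tailmass fineK//; apply: lint_density_fin; first exact: measurable_itv.
exact: sub_Rpy.
Qed.

Lemma mass_ge0 a b : 0 <= a -> 0 <= mass rho a b.
Proof.
move=> a0; rewrite -lee_fin -massE//; apply: lint_ge0 => x /(sub_Rp a0).
by rewrite /Rp/= in_itv/= andbT; exact: rho0.
Qed.

Lemma tailmass_ge0 a : 0 <= a -> 0 <= tailmass rho a.
Proof.
move=> a0; rewrite -lee_fin -tailmassE//; apply: lint_ge0 => x /(sub_Rpy a0).
by rewrite /Rp/= in_itv/= andbT; exact: rho0.
Qed.

End density.

(** The upper bound [u] is arbitrary, so that one statement serves half-open, closed and unbounded
    intervals. *)
Lemma lint_itv_split (u : itv_bound R) f a b : 0 <= a -> a <= b -> (BLeft b <= u)%O ->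
  lmeas Rp f -> (forall t, 0 <= t -> 0 <= f t) ->
  lint [set` Interval (BLeft a) u] f =
  (lint `[a, b[ f + lint [set` Interval (BLeft b) u] f)%E.
Proof.
move=> a0 ab bu mf f0.
have ab' : (BLeft a <= BLeft b :> itv_bound R)%O by rewrite bnd_simp.
rewrite (itv_bndbnd_setU ab' bu) lint_setU// -?(itv_bndbnd_setU ab' bu).
- apply: lmeasS mf; first exact: measurable_itv.
  move=> x /=; rewrite itv_boundlr => /andP[]; rewrite bnd_simp => /(le_trans a0) x0 _.
  by rewrite /Rp/= in_itv/= x0.
- by move=> x /=; rewrite itv_boundlr => /andP[]; rewrite bnd_simp => /(le_trans a0) /f0.
- apply/disj_setPLR => x /=; rewrite in_itv/= => /andP[_ xb].
  rewrite itv_boundlr => /andP[]; rewrite bnd_simp => bx _.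
  by move: (lt_le_trans xb bx); rewrite ltxx.
Qed.

Section density2.
Variable rho : R -> R.
Hypothesis rhoD : is_density rho.
Let rho0 t : 0 <= t -> 0 <= rho t. Proof. by case: rhoD => + _ _; exact. Qed.
Let mrho : lmeas Rp rho. Proof. by case: rhoD. Qed.

Lemma massD a b c : 0 <= a -> a <= b -> b <= c -> mass rho a c = mass rho a b + mass rho b c.
Proof.
move=> a0 ab bc; apply: EFin_inj; have b0 := le_trans a0 ab.
by rewrite EFinD -!massE// (@lint_itv_split _ _ a b)// bnd_simp.
Qed.

Lemma tailmassD a b : 0 <= a -> a <= b -> tailmass rho a = mass rho a b + tailmass rho b.
Proof.
move=> a0 ab; apply: EFin_inj; have b0 := le_trans a0 ab.
by rewrite EFinD -massE// -!tailmassE// (@lint_itv_split _ _ a b)// bnd_simp.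
Qed.

Lemma tailmass0 : tailmass rho 0 = 1.
Proof. by rewrite /tailmass; case: rhoD => _ _ ->. Qed.

Lemma mass_tail a : 0 <= a -> mass rho 0 a = 1 - tailmass rho a.
Proof. by move=> a0; rewrite -tailmass0 (tailmassD _ a0)// addrK. Qed.

Lemma mass_sum (x : nat -> R) (n : nat) : 0 <= x 0%N -> {homo x : i j / (i <= j)%N >-> i <= j} ->
  mass rho (x 0%N) (x n) = \sum_(i < n) mass rho (x i) (x i.+1).
Proof.
move=> x0 xm; elim: n => [|n IH].
  by rewrite big_ord0 /mass set_itvco0 // /lint integral_set0.
rewrite big_ord_recr/= -IH -massD//; exact: xm.
Qed.

End density2.

Lemma le_mass rho a b (M : R) : is_density rho -> 0 <= a -> a <= b ->
  (forall t, a <= t < b -> rho t <= M) -> mass rho a b <= M * (b - a).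
Proof.
move=> rhoD a0 ab H; rewrite -lee_fin -massE//.
apply: (@le_trans _ _ (lint `[a, b[ (fun=> M))).
  apply: le_lint.
  - exact: measurable_itv.
  - exact/lmeas_density/sub_Rp.
  - by apply: lmeas_borel => //; exact: measurable_itv.
  - move=> x /(sub_Rp a0); rewrite /Rp/= in_itv/= andbT; case: rhoD => + _ _; exact.
  - by move=> x /=; rewrite in_itv/=; exact: H.
rewrite lint_cst lebesgue_measure_itv/= lte_fin.
case: ltP => ba; first by rewrite -EFinB -EFinM.
have -> : b = a by apply/le_anti; rewrite ab ba.
by rewrite subrr mulr0 mule0.
Qed.

Lemma ge_mass rho a b (M : R) : is_density rho -> 0 <= a -> a <= b ->
  (forall t, a <= t < b -> M <= rho t) -> M * (b - a) <= mass rho a b.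
Proof.
(* A negative [M] is allowed and trivial; it would break the comparison of nonnegative integrands
   below. *)
move=> rhoD a0 ab H; have [M0|M0] := leP 0 M; last first.
  by rewrite (@le_trans _ _ 0) ?mass_ge0// nmulr_rle0// subr_ge0.
rewrite -lee_fin -massE//.
apply: (@le_trans _ _ (lint `[a, b[ (fun=> M))).
  rewrite lint_cst lebesgue_measure_itv/= lte_fin.
  case: ltP => ba; first by rewrite -EFinB -EFinM.
  by have -> : b = a by [apply/le_anti; rewrite ab ba]; rewrite subrr mulr0 mule0.
apply: le_lint => //.
- by apply: lmeas_borel => //; exact: measurable_itv.
- exact/lmeas_density/sub_Rp.
Qed.

Lemma lint_itvcc f a b : 0 <= a -> a <= b -> lmeas Rp f -> (forall t, 0 <= t -> 0 <= f t) ->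
  lint `[a, b] f = lint `[a, b[ f.
Proof.
move=> a0 ab mf f0; rewrite (@lint_itv_split _ _ a b)//; last by rewrite bnd_simp.
rewrite -[RHS]adde0; congr (_ + _)%E.
rewrite (@eq_lint _ _ _ (fun=> f b)).
  by rewrite lint_cst lebesgue_measure_itv/= ltxx mule0.
by move=> x /=; rewrite in_itv/= -eq_le => /eqP<-.
Qed.

(** Monotone convergence along intervals exhausting the open half-line; the missing point 0 is null.
    The cut near 0 is needed because piecewise continuity says nothing about [mu] at 0. *)
Lemma density_exhaust rho (e : R) : is_density rho -> 0 < e ->
  exists a b : R, [/\ 0 < a, a < b, mass rho 0 a <= e & tailmass rho b <= e].
Proof.
move=> rhoD e0.
pose F (i : nat) : set R := `[i.+1%:R^-1, i.+1%:R + 1[%classic.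
have F0 i x : F i x -> 0 < x.
  by rewrite /F/= in_itv/= => /andP[+ _]; apply: lt_le_trans; rewrite invr_gt0.
have UF : \bigcup_i F i = `]0, +oo[%classic.
  apply/seteqP; split => x; first by move=> [i _ /F0 x0] /=; rewrite in_itv/= x0.
  rewrite /= in_itv/= andbT => x0.
  have xi : 0 < x^-1 by rewrite invr_gt0.
  have xn := truncnS_gt (x + x^-1); exists (Num.truncn (x + x^-1)) => //.
  rewrite /F/= in_itv/=; move: xn; set n := _.+1%:R => xn.
  apply/andP; split; last by lra.
  by rewrite invf_ple ?posrE//; lra.
have r0 t : 0 <= t -> 0 <= rho t by case: rhoD => + _ _; exact.
have mR : lmeas Rp rho by case: rhoD.
have FR i : F i `<=` Rp by move=> x /F0; rewrite /Rp/= in_itv/= andbT => /ltW.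
have cv : lint (F i) rho @[i --> \oo] --> lint (\bigcup_i F i) rho.
  apply: ge0_nondecreasing_set_cvg_integral.
  - move=> i j ij; apply/subsetPset => x; rewrite /F/= !in_itv/= => /andP[xi xj].
    apply/andP; split.
      by apply: le_trans xi; rewrite lef_pV2 ?posrE// ler_nat.
    by apply: (lt_le_trans xj); rewrite lerD2r ler_nat.
  - by move=> i; apply: measurable_CR; exact: measurable_itv.
  - move=> i; apply/measurable_EFinP/lmeasE; apply: lmeasS mR => //.
    exact: measurable_itv.
  - by move=> i x /F0 x0; rewrite lee_fin r0// ltW.
have E1 : lint (\bigcup_i F i) rho = 1%E.
  rewrite UF; have <- : lint Rp rho = 1%E by case: rhoD.
  rewrite (_ : Rp = `[0, 0]%classic `|` `]0, +oo[%classic); last first.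
    apply/seteqP; split => x; rewrite /Rp/= !in_itv/= !andbT -eq_le.
      by rewrite le_eqVlt => /orP[/eqP->|]; [left|right].
    by case=> [/eqP->|/ltW].
  rewrite lint_setU.
  - rewrite (@eq_lint _ `[0, 0]%classic _ (fun=> rho 0)).
      by rewrite lint_cst lebesgue_measure_itv/= ltxx mule0 add0e.
    by move=> x /=; rewrite in_itv/= -eq_le => /eqP<-.
  - exact: measurable_itv.
  - exact: measurable_itv.
  - apply: lmeasS mR; first exact: measurable_itv.
    move=> x; rewrite /Rp/= !in_itv/= !andbT -eq_le; by case=> [/eqP->|/ltW].
  - by move=> x /= [|]; rewrite in_itv/= ?andbT; [move=> /andP[/r0]|move=> /ltW/r0].
  - apply/disj_setPLR => x /=; rewrite !in_itv/= andbT => /andP[_ x0] /(le_lt_trans x0).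
    by rewrite ltxx.
rewrite E1 in cv.
have mF i : lint (F i) rho = (mass rho i.+1%:R^-1 (i.+1%:R + 1))%:E by rewrite massE// invr_ge0.
have cv1 : fine (lint (F i) rho) @[i --> \oo] --> (1 : R) by exact: fine_cvg cv.
move: cv1 => /cvgrPdist_le /(_ e e0) [N _ /(_ N (leqnn N))] /=.
rewrite -/(mass rho _ _); set a := N.+1%:R^-1; set b := N.+1%:R + 1 => H.
have a0 : 0 < a by rewrite invr_gt0.
have a1 : a <= 1 by rewrite invf_le1// ler1n.
have ab : a < b by rewrite (le_lt_trans a1)// /b ltrDr.
exists a, b; have b0 := ltW (lt_trans a0 ab).
have M1 := mass_ge0 rhoD a (lexx 0); have M2 := tailmass_ge0 rhoD b0.
have := tailmassD rhoD (lexx 0) b0; rewrite (massD rhoD (lexx 0) (ltW a0) (ltW ab)) tailmass0// => E.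
split => //; move: H; rewrite ler_norml => /andP[]; lra.
Qed.

Lemma lint_scale rho l a (u : R) : 0 < l -> 0 <= a -> lmeas Rp rho -> (forall t, 0 <= t -> 0 <= rho t) ->
  lint `[a, u[ (scale_dens rho l) = lint `[l * a, l * u[ rho.
Proof.
move=> l0 a0 mr r0; have la0 : 0 <= l * a by rewrite mulr_ge0// ltW.
have mla : lmeas `[l * a, l * u[ rho.
  by apply: lmeasS mr; [exact: measurable_itv|exact: sub_Rp].
have r0' x : `[l * a, l * u[%classic x -> 0 <= rho x.
  by rewrite /= in_itv/= => /andP[+ _]; move=> /(le_trans la0); exact: r0.
have E : (fun x => l * x + 0) @^-1` `[l * a, l * u[ = `[a, u[%classic.
  by apply/seteqP; split => x /=; rewrite !in_itv/= addr0 ler_pM2l// ltr_pM2l.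
have := lint_affine 0 l0 (measurable_itv _) mla r0'; rewrite E => E1.
have := @lmeas_affine _ _ 0 _ _ l0 (measurable_itv _) mla; rewrite E => E2.
rewrite /scale_dens.
rewrite (@eq_lint _ _ _ (fun x => l * rho (l * x + 0))); last by move=> x _; rewrite addr0.
rewrite lintZl ?(ltW l0)//.
- by rewrite E1 muleA -EFinM divff ?mul1e// gt_eqF.
- by move=> x /=; rewrite in_itv/= addr0 => /andP[ax _]; rewrite r0// mulr_ge0 ?(ltW l0)// (le_trans a0).
Qed.

Lemma scale_density rho l : 0 < l -> is_density rho -> is_density (scale_dens rho l).
Proof.
move=> l0 [r0 mr r1]; have E : (fun x => l * x + 0) @^-1` Rp = @Rp R.
  by apply/seteqP; split => x; rewrite /Rp/= !in_itv/= !andbT addr0 pmulr_rge0.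
have r0' x : @Rp R x -> 0 <= rho x by rewrite /Rp/= in_itv/= andbT; exact: r0.
have := lint_affine 0 l0 (measurable_itv _) mr r0'; rewrite E => E1.
have := @lmeas_affine _ _ 0 _ _ l0 (measurable_itv _) mr; rewrite E => E2.
have F : scale_dens rho l = (fun x => l * rho (l * x + 0)).
  by apply/funext => x; rewrite addr0.
rewrite F; split.
- by move=> t t0; rewrite addr0 mulr_ge0 ?r0 ?mulr_ge0// ltW.
- apply: lmeasM => //; apply: lmeas_borel => //; exact: measurable_itv.
rewrite lintZl ?(ltW l0)//.
- by rewrite E1 -/Rp r1 mule1 -EFinM divff// gt_eqF.
- exact: measurable_itv.
- by move=> x; rewrite /Rp/= in_itv/= andbT addr0 => x0; rewrite r0// mulr_ge0// ltW.
Qed.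

Lemma mass_scale rho l a u : 0 < l -> 0 <= a -> is_density rho ->
  mass (scale_dens rho l) a u = mass rho (l * a) (l * u).
Proof. by move=> l0 a0 [r0 mr r1]; rewrite /mass lint_scale. Qed.

(** The factor [c] disappears by normalisation: since a scaling has mass 1, the tail mass at [T]
    must be [c / s]. *)
Lemma shift_selfsimilar rho (T s c : R) : is_density rho -> 0 <= T -> 0 < s -> 0 < c ->
  (forall t, 0 <= t -> rho (T + t) = c * rho (s * t)) ->
  forall t, 0 <= t -> shift_dens rho T t = scale_dens rho s t.
Proof.
move=> rhoD T0 s0 c0 H t t0.
have [r0 mr r1] := rhoD; have [sr0 smr sr1] := scale_density s0 rhoD.
have r0' x : `[T, +oo[%classic x -> 0 <= rho x.
  by rewrite /= in_itv/= andbT => /(le_trans T0); exact: r0.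
have mT : lmeas `[T, +oo[ rho.
  by apply: lmeasS mr; [exact: measurable_itv|exact: sub_Rpy].
have E : (fun x => 1 * x + T) @^-1` `[T, +oo[ = @Rp R.
  by apply/seteqP; split => x; rewrite /Rp/= !in_itv/= !andbT mul1r lerDr.
have := lint_affine T ltr01 (measurable_itv _) mT r0'; rewrite E invr1 mul1e => E1.
have tmE : tailmass rho T = c / s.
  rewrite /tailmass -E1 (@eq_lint _ _ _ (fun x => (c / s) * scale_dens rho s x)); last first.
    move=> x; rewrite /Rp/= in_itv/= andbT => x0; rewrite mul1r addrC H// /scale_dens.
    by field; rewrite gt_eqF.
  rewrite lintZl//; first by rewrite sr1 mule1.
  - exact: measurable_itv.
  - by move=> x; rewrite /Rp/= in_itv/= andbT; exact: sr0.
  - by rewrite divr_ge0// ltW.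
rewrite /shift_dens tmE addrC H// /scale_dens; by field; rewrite !gt_eqF.
Qed.

End Mass.

(** * Densities constant on unit cells *)

Section StepDensity.
Variable R : realType.
Implicit Types (p : nat -> R) (f : R -> R).

(** This realises a finite weight sequence as a density, to which the dynamic programming principle
    applies. *)
Definition stepd p (N : nat) : R -> R :=
  fun t => \sum_(k < N) p k * \1_(`[(k%:R : R), k.+1%:R[%classic) t.

Lemma stepdE p (N k : nat) (t : R) : k%:R <= t < k.+1%:R ->
  stepd p N t = if (k < N)%N then p k else 0.
Proof.
move=> kt; rewrite /stepd.
have I (i : nat) : \1_(`[(i%:R : R), i.+1%:R[%classic) t = (i == k)%:R :> R.
  rewrite indicE; congr (nat_of_bool _)%:R; apply/idP/eqP => [|->]; last first.
    by rewrite mem_set//= in_itv.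
  rewrite inE/= in_itv/= => it; move/andP: kt => [k1 k2]; move/andP: it => [i1 i2].
  have ik : (i < k.+1)%N by rewrite -(ltr_nat R); exact: le_lt_trans k2.
  have ki : (k < i.+1)%N by rewrite -(ltr_nat R); exact: le_lt_trans i2.
  by apply/eqP; rewrite eqn_leq -ltnS ik -ltnS ki.
under eq_bigr do rewrite I.
case: ifP => kN.
  rewrite (bigD1 (Ordinal kN))//= eqxx mulr1 big1 ?addr0// => i ik.
  by rewrite (_ : (i : nat) == k = false) ?mulr0//; apply: contraNF ik => /eqP ik; apply/eqP/val_inj.
rewrite big1// => i _; rewrite (_ : (i : nat) == k = false) ?mulr0//.
by apply/eqP => ik; move: (ltn_ord i); rewrite ik kN.
Qed.

Lemma stepd_ge0 p (N : nat) t : (forall k, 0 <= p k) -> 0 <= stepd p N t.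
Proof. by move=> p0; apply: sumr_ge0 => i _; rewrite mulr_ge0// indicE. Qed.

Lemma lmeas_stepd p (N : nat) : lmeas Rp (stepd p N).
Proof.
apply: lmeas_borel; first exact: measurable_itv.
apply: measurable_sum => i; apply: measurable_funM => //.
Qed.

Lemma lint_cells f (n : nat) : lmeas Rp f -> (forall t, 0 <= t -> 0 <= f t) ->
  lint `[0, n%:R[ f = (\sum_(k < n) lint `[k%:R, k.+1%:R[ f)%E.
Proof.
move=> mf f0; elim: n => [|n IH]; first by rewrite big_ord0 /lint set_itvco0 integral_set0.
by rewrite big_ord_recr/= -IH (@lint_itv_split _ _ _ 0 n%:R)// bnd_simp ler_nat.
Qed.

Lemma lint_stepd_cell p (N k : nat) :
  lint `[k%:R, k.+1%:R[ (stepd p N) = (if (k < N)%N then p k else 0)%:E.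
Proof.
rewrite (@eq_lint _ _ _ (fun=> if (k < N)%N then p k else 0)); last first.
  by move=> x /=; rewrite in_itv/=; exact: stepdE.
rewrite lint_cst lebesgue_measure_itv/= lte_fin ltr_nat ltnSn -EFinB -EFinM.
by rewrite -natrB// subSnn mulr1.
Qed.

Lemma stepd_ge p (N : nat) t : N%:R <= t -> stepd p N t = 0.
Proof.
move=> Nt; have t0 : 0 <= t by exact: le_trans Nt.
rewrite (stepdE _ _ (truncn_itv t0)) ltnNge.
by rewrite truncn_ge_nat// Nt.
Qed.

Lemma stepd_tail p (N n : nat) : (N <= n)%N -> lint `[n%:R, +oo[ (stepd p N) = 0%E.
Proof.
move=> Nn; rewrite (@eq_lint _ _ _ (fun=> 0)); first by rewrite lint_cst mul0e.
move=> x /=; rewrite in_itv/= andbT => nx; apply: stepd_ge.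
by apply: le_trans nx; rewrite ler_nat.
Qed.

Lemma stepd_density p (N : nat) : (forall k, 0 <= p k) -> \sum_(k < N) p k = 1 ->
  is_density (stepd p N).
Proof.
move=> p0 p1; split; [by move=> t _; exact: stepd_ge0|exact: lmeas_stepd|].
rewrite /Rp (@lint_itv_split _ _ _ 0 N%:R)//; last 2 first.
- exact: lmeas_stepd.
- by move=> t _; exact: stepd_ge0.
rewrite stepd_tail// adde0 lint_cells; last 2 first.
- exact: lmeas_stepd.
- by move=> t _; exact: stepd_ge0.
under eq_bigr do rewrite lint_stepd_cell ltn_ord.
by rewrite sumEFin p1.
Qed.

Lemma mass_stepd p (N k : nat) : mass (stepd p N) k%:R k.+1%:R = if (k < N)%N then p k else 0.
Proof. by rewrite /mass lint_stepd_cell. Qed.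

Lemma stepd_shift p (N n : nat) t : (n <= N)%N -> 0 <= t ->
  stepd p N (t + n%:R) = stepd (fun k => p (n + k)%N) (N - n) t.
Proof.
move=> nN t0; have /andP[k1 k2] := truncn_itv t0.
rewrite (@stepdE _ _ (n + Num.truncn t)); last first.
  by rewrite addrC natrD -addnS natrD lerD2l ltrD2l k1.
by rewrite (@stepdE _ _ (Num.truncn t)) ?k1// ltn_subRL.
Qed.

Lemma stepdZ c p (N : nat) t : stepd (fun k => c * p k) N t = c * stepd p N t.
Proof. by rewrite /stepd mulr_sumr; apply: eq_bigr => i _; rewrite mulrA. Qed.

End StepDensity.

(** * Piecewise continuous functions *)

Section Regulated.
Variable R : realType.

(** Real induction from [b] down to [a], in place of a finite subdivision extracted by compactness.
    The infimum of the points satisfying [P] satisfies it by a step to its right, and cannot exceed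
    [a] by a step to its left. No step crosses [x], so the left and right limits at [x] may
    differ. *)
Lemma regulated_induction (P : R -> Prop) (a b : R) : a <= b -> P b ->
  (forall x, a <= x <= b -> exists2 d : R, 0 < d & forall u v, a <= u -> u < v -> v <= b ->
     (x - d < u /\ v <= x) \/ (x <= u /\ v < x + d) -> P v -> P u) ->
  P a.
Proof.
move=> ab Pb H; pose S := [set x | a <= x <= b /\ P x].
have Sb : S b by split; rewrite ?ab ?lexx.
have lbS : lbound S a by move=> x [/andP[]].
have hS : has_inf S by split; [exists b|exists a].
have ai : a <= inf S by apply: lb_le_inf => //; exists b.
have ib : inf S <= b by apply: ge_inf => //; exists a.
have [d d0 Hd] := H (inf S) (introT andP (conj ai ib)).
have [v [/andP[av vb] Pv] vi] := inf_adherent d0 hS.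
have iv : inf S <= v by apply: ge_inf; [exists a|split=> //; rewrite av vb].
have Pi : P (inf S).
  move: iv; rewrite le_eqVlt => /orP[/eqP->//|iv].
  by apply: (Hd (inf S) v) => //; right; split.
move: ai; rewrite le_eqVlt => /orP[/eqP->//|ai].
pose u := Num.max a (inf S - d / 2).
have ui : u < inf S by rewrite /u gt_max ai/=; lra.
have du : inf S - d < u by rewrite /u lt_max; apply/orP; right; lra.
have au : a <= u by rewrite /u le_max lexx.
have Pu : P u by apply: (Hd u (inf S)) => //; left; split.
have : inf S <= u.
  by apply: ge_inf; [exists a|split=> //; rewrite au/= (le_trans (ltW ui))].
by rewrite leNgt ui.
Qed.

Lemma cvg_left_dist (f : R -> R) (x : R) : cvg (f @ at_left x) -> forall e : R, 0 < e ->
  exists h d : R, 0 < d /\ forall t, x - d < t < x -> `|f t - h| <= e.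
Proof.
move=> cf e e0; exists (lim (f @ at_left x)).
have /cvgrPdist_le/(_ e e0) := cf.
rewrite near_withinE => /nbhs_ballP[d /= d0 Hd]; exists d; split => // t /andP[t1 t2].
by rewrite distrC; apply: Hd => //; rewrite /ball/= ger0_norm; lra.
Qed.

Lemma cvg_right_dist (f : R -> R) (x : R) : cvg (f @ at_right x) -> forall e : R, 0 < e ->
  exists h d : R, 0 < d /\ forall t, x < t < x + d -> `|f t - h| <= e.
Proof.
move=> cf e e0; exists (lim (f @ at_right x)).
have /cvgrPdist_le/(_ e e0) := cf.
rewrite near_withinE => /nbhs_ballP[d /= d0 Hd]; exists d; split => // t /andP[t1 t2].
by rewrite distrC; apply: Hd => //; rewrite /ball/= ler0_norm; lra.
Qed.

(** One-sided limits give the heights. They are raised to at least [e] because block heights are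
    divided by later; this preserves the bound, since [mu >= 0] and a height below [e] force [mu]
    into [[0, 2 e]]. *)
Lemma pw_continuous_regulated (mu : R -> R) (a b x e : R) : (forall t, 0 <= t -> 0 <= mu t) ->
  pw_continuous mu -> 0 < a -> a < b -> a <= x <= b -> 0 < e ->
  exists hl hr d, [/\ [/\ 0 < hl, 0 < hr, 0 < d & d <= a],
    (forall t, x - d < t < x -> `|mu t - hl| <= e) &
    (forall t, x < t < x + d -> `|mu t - hr| <= e)].
Proof.
move=> mu0 pw a0 ab xab e0; have [s [cs1 cs2]] := pw _ _ a0 ab.
have [cl cr] : cvg (mu @ at_left x) /\ cvg (mu @ at_right x).
  have [xs|xs] := boolP (x \in s); first exact: cs2.
  have c : mu @ nbhs x --> mu x by exact: cs1.
  by split; apply/cvg_ex; exists (mu x); [exact: cvg_at_left_filter|exact: cvg_at_right_filter].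
have [hl [dl [dl0 Hl]]] := cvg_left_dist cl e0.
have [hr [dr [dr0 Hr]]] := cvg_right_dist cr e0.
have mx (h t : R) : 0 <= mu t -> `|mu t - h| <= e -> `|mu t - Num.max h e| <= e.
  move=> t0; rewrite /Num.max; case: ltP => // he; rewrite !ler_norml => /andP[]; lra.
have [x0 x1] : a <= x /\ x <= b by apply/andP.
exists (Num.max hl e), (Num.max hr e), (Num.min (Num.min dl dr) a); split.
- by rewrite !lt_max !lt_min e0 !orbT dl0 dr0 a0 ge_min lexx orbT.
- move=> t /andP[t1 t2].
  have [m1 m2] : Num.min (Num.min dl dr) a <= dl /\ Num.min (Num.min dl dr) a <= a.
    by rewrite !ge_min !lexx !orbT.
  apply: mx; first by apply: mu0; lra.
  by apply: Hl; apply/andP; split; lra.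
- move=> t /andP[t1 t2].
  have m1 : Num.min (Num.min dl dr) a <= dr by rewrite !ge_min !lexx !orbT.
  apply: mx; first by apply: mu0; lra.
  by apply: Hr; apply/andP; split; lra.
Qed.

End Regulated.

(** * Limits restated with thresholds *)

Section Filters.
Variable R : realType.

Lemma near_right0P (P : R -> Prop) : (\forall l \near (0 : R)^'+, P l) <->
  exists2 l0 : R, 0 < l0 & forall l, 0 < l < l0 -> P l.
Proof.
split=> [|[l0 l00 H]]; last first.
  near=> l; apply: H; apply/andP; split; near: l.
    exact: nbhs_right_gt.
  exact: nbhs_right_lt.
rewrite near_withinE => /nbhs_ballP[d /= d0 Hd]; exists d => // l /andP[l1 l2].
by apply: Hd => //; rewrite /ball/= sub0r normrN gtr0_norm.
Unshelve. all: by end_near. Qed.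

Lemma near_pinftyP (P : R -> Prop) : (\forall t \near +oo, P t) <->
  exists M : R, forall t, M < t -> P t.
Proof.
split=> [[M [_ HM]]|[M HM]]; first by exists M.
by exists M; split => //; exact: num_real.
Qed.

(** The point [w0] keeps the supremum nonnegative; over an empty type it would be minus infinity. *)
Lemma dev_cvg0P (Omega : Type) (w0 : Omega) (T : Type) (F : set_system T) (FF : Filter F)
    (f : T -> Omega -> R) (U : Omega -> R) :
  dev (f t) U @[t --> F] --> 0%E <->
  forall e : R, 0 < e -> \forall t \near F, forall w, `|f t w - U w| <= e.
Proof.
have dev_ub t w : (`|f t w - U w|%:E <= dev (f t) U)%E.
  by apply: ereal_sup_ubound; exists w.
have dev_ge0 t : (0 <= dev (f t) U)%E by apply: le_trans (dev_ub t w0); rewrite lee_fin.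
have dev_le t e : (forall w, `|f t w - U w| <= e) -> (dev (f t) U <= e%:E)%E.
  by move=> H; apply: ge_ereal_sup => _ [w _ <-]; rewrite lee_fin.
split.
  move=> /fine_cvgP[fn /cvgrPdist_le cv] e e0; have ce := cv e e0.
  near=> t => w; have ft : dev (f t) U \is a fin_num by near: t.
  have : `|0 - fine (dev (f t) U)| <= e by near: t.
  rewrite sub0r normrN ger0_norm ?fine_ge0// => H.
  by rewrite -lee_fin (le_trans (dev_ub t w))// -(fineK ft) lee_fin.
move=> H; have fn : \forall t \near F, dev (f t) U \is a fin_num.
  apply: filterS (H 1 ltr01) => t /dev_le H1.
  by rewrite ge0_fin_numE// (le_lt_trans H1)// ltry.
apply/fine_cvgP; split => //; apply/cvgrPdist_le => e e0.
near=> t; have ft : dev (f t) U \is a fin_num by near: t.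
rewrite /= sub0r normrN ger0_norm ?fine_ge0//.
rewrite -lee_fin fineK//; apply: dev_le; near: t; exact: H.
Unshelve. all: by end_near. Qed.

End Filters.

(** * Uniform, exponential and power densities *)

Section ConcreteDensities.
Variable R : realType.

Lemma unifd1E (t : R) : unifd 1 t = \1_(`[0, 1]%classic) t.
Proof.
rewrite /unifd indicE invr1; case: ifP => H.
  by rewrite mem_set//= in_itv.
by rewrite memNset//= in_itv/= H.
Qed.

Lemma unifd1_density : is_density (@unifd R 1).
Proof.
have -> : unifd 1 = \1_(`[0, 1]%classic) :> (R -> R) by apply/funext => t; exact: unifd1E.
have mR : measurable (@Rp R) by exact: measurable_itv.
have mI : measurable_fun Rp (\1_(`[0, 1]%classic) : R -> R).
  by apply: measurable_indic; exact: measurable_itv.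
have I0 t : 0 <= \1_(`[0, 1]%classic) t :> R by rewrite indicE.
split => //; first exact: lmeas_borel.
rewrite lint_lebesgue// integral_indic// setIidl; last first.
  by move=> x; rewrite /Rp/= !in_itv/= andbT => /andP[].
by have /= := lebesgue_measure_itv (`[0, 1] : interval R); rewrite lte_fin ltr01 sube0.
Qed.

Lemma unifdE (T : R) : 0 < T -> unifd T = scale_dens (unifd 1) T^-1.
Proof.
move=> T0; apply/funext => t; rewrite /unifd /scale_dens.
rewrite pmulr_rge0 ?invr_gt0// [T^-1 * t]mulrC ler_pdivrMr// mul1r invr1.
by case: ifP; rewrite ?mulr1 ?mulr0.
Qed.

Lemma unifd_density (T : R) : 0 < T -> is_density (unifd T).
Proof.
move=> T0; rewrite unifdE//; apply: scale_density; last exact: unifd1_density.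
by rewrite invr_gt0.
Qed.

Lemma near_eq_cst_cvg (F : set_system R) (FF : Filter F) (f : R -> R) (c : R) :
  (\forall t \near F, f t = c) -> f @ F --> c.
Proof.
move=> H; apply/cvgrPdist_le => e e0; apply: filterS H => t ->.
by rewrite subrr normr0 ltW.
Qed.

Lemma unifd1_pw_continuous : pw_continuous (@unifd R 1).
Proof.
move=> a b a0 ab; exists [:: 1]; split.
  move=> x /andP[ax xb]; rewrite inE => x1.
  have x0 : 0 < x by exact: lt_le_trans ax.
  apply: near_eq_cst_cvg; rewrite /unifd (ltW x0)/=.
  have [xl|xg|xe] := ltgtP x 1; last by rewrite xe eqxx in x1.
    near=> t; have t0 : 0 < t by near: t; exact: lt_nbhsr.
    have t1 : t < 1 by near: t; exact: lt_nbhsl.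
    by rewrite (ltW t0) (ltW t1).
  near=> t; have t1 : 1 < t by near: t; exact: lt_nbhsr.
  by rewrite (leNgt t) t1 andbF.
move=> x; rewrite inE => /eqP->; split.
  apply/cvg_ex; exists 1; apply: near_eq_cst_cvg.
  near=> t; have t0 : 0 < t by near: t; exact: nbhs_left_gt.
  have t1 : t < 1 by near: t; exact: nbhs_left_lt.
  by rewrite /unifd (ltW t0) (ltW t1) invr1.
apply/cvg_ex; exists 0; apply: near_eq_cst_cvg.
near=> t; have t1 : 1 < t by near: t; exact: nbhs_right_gt.
by rewrite /unifd (leNgt t) t1 andbF.
Unshelve. all: by end_near. Qed.

Lemma expd1_density : is_density (@expd R 1).
Proof.
have ex0 x : 0 <= @expd R 1 x by rewrite /expd mul1r expR_ge0.
have mex : measurable_fun setT (@expd R 1).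
  apply: continuous_measurable_fun => x; rewrite /expd.
  apply: cvgM; first exact: cvg_cst.
  apply: continuous_comp; last exact: continuous_expR.
  apply: cvgN; apply: cvgM; [exact: cvg_cst|exact: cvg_id].
have mRp : measurable (@Rp R) by exact: measurable_itv.
have mexR : measurable_fun Rp (@expd R 1) by exact: measurable_funS mex.
split => //; first exact: lmeas_borel.
rewrite lint_lebesgue// -(integral_exponential_pdf (@ltr01 R)) integral_mkcond.
apply: eq_integral => x _; rewrite restrict_EFin; congr EFin.
rewrite /exponential_pdf !patchE; case: ifP => // _.
by rewrite /expd mulNr.
Qed.

Lemma expdE (l : R) : expd l = scale_dens (expd 1) l.
Proof. by apply/funext => t; rewrite /expd /scale_dens !mul1r. Qed.

Lemma expd1_pw_continuous : pw_continuous (@expd R 1).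
Proof.
move=> a b _ _; exists [::]; split => // x _ _; rewrite /expd.
apply: cvgM; first exact: cvg_cst.
apply: continuous_comp; last exact: continuous_expR.
apply: cvgN; apply: cvgM; [exact: cvg_cst|exact: cvg_id].
Qed.

(** The exponential law is memoryless, so [s = 1]: a shift does not rescale. *)
Lemma expd1_selfsimilar (r : R) : 0 <= r -> exists s c : R, [/\ 0 < s <= 1, 0 < c &
  forall t, 0 <= t -> expd 1 (r + t) = c * expd 1 (s * t)].
Proof.
move=> r0; exists 1, (expR (- r)); split; [by rewrite ltr01 lexx|exact: expR_gt0|].
by move=> t t0; rewrite /expd !mul1r opprD expRD.
Qed.

Section Power.
Variables (rho : R -> R) (f0 k c : R).
Hypotheses (f00 : 0 < f0) (k0 : 0 < k) (c0 : 0 < c).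
Hypothesis rhoE : forall t, 0 <= t -> rho t = f0 * expR (- c * ln (1 + k * t)).

Let kt (t : R) : 0 <= t -> 0 <= k * t.
Proof. by move=> t0; rewrite mulr_ge0// ltW. Qed.

Lemma power_le t : 0 <= t -> rho t <= f0.
Proof.
move=> t0; rewrite rhoE// ler_piMr ?(ltW f00)// -[leRHS]expR0 ler_expR mulNr oppr_le0 mulr_ge0 ?(ltW c0)//.
by rewrite ln_ge0// lerDl kt.
Qed.

(** The tangent at 0 as a lower bound, from [1 + x <= expR x] and [ln (1 + x) <= x]. *)
Lemma power_ge t : 0 <= t -> f0 * (1 - (c * k) * t) <= rho t.
Proof.
move=> t0; rewrite rhoE// ler_pM2l// (le_trans _ (expR_ge1Dx _))// lerD2l mulNr lerN2 -mulrA ler_pM2l//.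
by apply: le_ln1Dx; rewrite (lt_le_trans _ (kt t0))// ltrN10.
Qed.

(** The base factors: [1 + k (T + t) = (1 + k T) (1 + k t / (1 + k T))]. *)
Lemma power_selfsimilar (T t : R) : 0 <= T -> 0 <= t ->
  rho (T + t) = expR (- c * ln (1 + k * T)) * rho ((1 + k * T)^-1 * t).
Proof.
move=> T0 t0; have kT := kt T0; have k1 : 0 < 1 + k * T by lra.
have s0 : 0 <= (1 + k * T)^-1 * t by rewrite mulr_ge0// invr_ge0 ltW.
have ks := kt s0.
rewrite !rhoE ?addr_ge0// mulrCA -expRD -mulrDr -lnM ?posrE//; last by lra.
by congr (_ * expR (_ * ln _)); field; rewrite gt_eqF.
Qed.

Lemma power_selfsimilar_ex (r : R) : 0 <= r -> exists s c : R, [/\ 0 < s <= 1, 0 < c &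
  forall t, 0 <= t -> rho (r + t) = c * rho (s * t)].
Proof.
move=> r0; have kr := kt r0; have k1 : 0 < 1 + k * r by lra.
exists (1 + k * r)^-1, (expR (- c * ln (1 + k * r))); split.
- by rewrite invr_gt0 k1 invf_le1//; lra.
- exact: expR_gt0.
- by move=> t t0; exact: power_selfsimilar.
Qed.

(** As [T] runs over the half-line, the factor [1 / (1 + k T)] runs over all scales in [(0, 1]].
    This is what exchanges limits over shifts with limits over scalings. *)
Lemma power_shift (T : R) : is_density rho -> 0 <= T ->
  forall t, 0 <= t -> shift_dens rho T t = scale_dens rho (1 + k * T)^-1 t.
Proof.
move=> rD T0; have kT := kt T0; apply: (@shift_selfsimilar _ _ _ _ (expR (- c * ln (1 + k * T)))) => //.
- by rewrite invr_gt0; lra.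
- exact: expR_gt0.
- by move=> t t0; exact: power_selfsimilar.
Qed.

Lemma power_pw_continuous : pw_continuous rho.
Proof.
move=> a b a0 _; exists [::]; split => // x /andP[ax _] _.
have x0 : 0 < x by exact: lt_le_trans ax.
have cf : {for x, continuous (fun t => f0 * expR (- c * ln (1 + k * t)))}.
  apply: cvgM; first exact: cvg_cst.
  apply: continuous_comp; last exact: continuous_expR.
  apply: cvgM; first exact: cvg_cst.
  apply: continuous_comp; last by apply: continuous_ln; have := kt (ltW x0); lra.
  apply: cvgD; first exact: cvg_cst.
  by apply: cvgM; [exact: cvg_cst|exact: cvg_id].
change (rho @ x --> rho x); rewrite (rhoE (ltW x0)).
apply: cvg_trans cf; apply: near_eq_cvg.
near=> t; rewrite rhoE//; apply: ltW; near: t; exact: lt_nbhsr.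
Unshelve. all: by end_near. Qed.

End Power.

(** Factoring [a] out of [a + b t] gives [k = b / a] and [f0 = a^(-c)], the value at 0. In this form
    the bounds at 0 and the self-similarity can be read off. *)
Lemma power_densityE (rho : R -> R) : power_density rho -> exists f0 k c : R,
  [/\ 0 < f0, 0 < k, 0 < c & forall t, 0 <= t -> rho t = f0 * expR (- c * ln (1 + k * t))].
Proof.
move=> [_ [a [b [c [a0 b0 c0 H]]]]]; exists (expR (- c * ln a)), (b / a), c; split => //.
- exact: expR_gt0.
- exact: divr_gt0.
move=> t t0; have kt : 0 <= b / a * t by rewrite mulr_ge0// divr_ge0 ?ltW.
have -> : expR (- c * ln a) * expR (- c * ln (1 + b / a * t)) = expR (- c * ln (a * (1 + b / a * t))).
  by rewrite -expRD -mulrDr -lnM ?posrE//; lra.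
have E : a * (1 + b / a * t) = a + b * t by field; rewrite gt_eqF.
rewrite E H// /powR gt_eqF//.
by rewrite -E mulr_gt0//; lra.
Qed.

(** The witness is [(1 + t)^(-2)], with primitive [- 1 / (1 + t)]. Existence supplies the density
    asked for in (p) and keeps (q) from being vacuous. *)
Lemma power_density_ex : exists rho : R -> R, power_density rho.
Proof.
exists (fun t => (1 + 1 * t) `^ (- 2)); split; last by exists 1, 1, 2; split.
have E (t : R) : 0 <= t -> (1 + 1 * t) `^ (- 2) = (1 + t)^-1 ^+ 2.
  by move=> t0; rewrite mul1r powRN powR_mulrn ?addr_ge0// exprVn.
have cont (x : R) : 0 <= x -> {for x, continuous (fun t : R => (1 + t)^-1 ^+ 2)}.
  move=> x0; apply: cvgM; apply: cvgV; rewrite ?gt_eqF ?ltr_pwDl//;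
  by apply: cvgD; [exact: cvg_cst|exact: cvg_id].
have R0 x : @Rp R x -> 0 <= x by rewrite /Rp/= in_itv/= andbT.
have mRp : measurable (@Rp R) by exact: measurable_itv.
have cw : {within `[0, +oo[, continuous (fun t : R => (1 + t)^-1 ^+ 2)}.
  apply: continuous_in_subspaceT => x; rewrite inE/= in_itv/= andbT; exact: cont.
have mf : measurable_fun Rp (fun t : R => (1 + t)^-1 ^+ 2).
  exact: subspace_continuous_measurable_fun.
split.
- by move=> t t0; rewrite powR_ge0.
- apply: (@eq_lmeas _ _ (fun t : R => (1 + t)^-1 ^+ 2)); first by move=> x /R0 x0; rewrite E.
  exact: lmeas_borel.
rewrite (@eq_lint _ _ _ (fun t : R => (1 + t)^-1 ^+ 2)); last by move=> x /R0 x0; rewrite E.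
rewrite lint_lebesgue//; last by move=> x _; rewrite sqr_ge0.
have dF (x : R) : 0 < x -> is_derive x 1 (fun t : R => - (1 + t)^-1) ((1 + x)^-1 ^+ 2).
  move=> x0; have x1 : 1 + x != 0 by rewrite gt_eqF//; lra.
  have d1 : is_derive x (1 : R) (fun t : R => 1 + t) 1.
    by have := is_deriveD (is_derive_cst (1 : R) x 1) (is_derive_id x (1 : R)); rewrite add0r.
  have d2 := is_deriveV x1 d1.
  have d3 := is_deriveN d2.
  apply: is_derive_eq d3 _.
  by rewrite scaleNr opprK [_ *: _]mulr1 exprVn.
rewrite (@ge0_continuous_FTC2y _ _ (fun t : R => - (1 + t)^-1) _ 0)//.
- by rewrite addr0 invr1 -EFinB add0r opprK.
- by move=> x _; rewrite sqr_ge0.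
- rewrite -oppr0; apply: cvgN; apply/cvgrPdist_le => e e0; apply/near_pinftyP.
  exists (e^-1) => t et; have e1 : 0 < e^-1 by rewrite invr_gt0.
  rewrite sub0r normrN ger0_norm ?invr_ge0; last by lra.
  by rewrite invf_ple ?posrE//; lra.
- by move=> x x0; case: (dF x x0).
- apply/cvg_at_right_filter; apply: cvgN; apply: cvgV; first by rewrite addr0 oner_neq0.
  by apply: cvgD; [exact: cvg_cst|exact: cvg_id].
- move=> x; rewrite in_itv/= andbT => x0; rewrite derive1E; by case: (dF x x0).
Qed.

End ConcreteDensities.

Lemma sum_ord_cat (R : realType) (F : nat -> R) (n N : nat) : (n <= N)%N ->
  \sum_(k < N) F k = \sum_(k < n) F k + \sum_(k < N - n) F (n + k)%N.
Proof.
move=> nN; rewrite -!(big_mkord xpredT F) (@big_cat_nat _ _ _ n)//=; congr (_ + _).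
rewrite -{1}[n]add0n big_addn big_mkord.
by apply: eq_bigr => k _; rewrite addnC.
Qed.

(** * Values of the game *)

Section Game.
Variables (R : realType) (Omega : Type) (K : set (R -> Omega)).
Variables (g : Omega -> R) (V : ((R -> Omega) -> R) -> Omega -> R).
Hypothesis Hg : forall w, 0 <= g w <= 1.
Hypothesis Hgm : forall z, K z -> lmeas Rp (fun t => g (z t)).
Hypothesis HV : game_mapping K V.
Hypothesis HDPP : discrete_DPP g V.
Hypothesis Hper : forall z, K z -> forall (n : nat) (s : R), 0 < s < 1 ->
  z (n%:R + s) = z n%:R.
Implicit Types (p q : nat -> R) (c : (R -> Omega) -> R) (f : Omega -> R).

Let g_ge0 w : 0 <= g w. Proof. by case/andP: (Hg w). Qed.
Let g_le1 w : g w <= 1. Proof. by case/andP: (Hg w). Qed.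

Definition wsum p (n : nat) : (R -> Omega) -> R :=
  fun z => \sum_(k < n) p k * g (z k%:R).

Definition cells (rho : R -> R) (k : nat) : R := mass rho k%:R k.+1%:R.

Lemma bounded_onD c1 c2 : bounded_on K c1 -> bounded_on K c2 ->
  bounded_on K (fun z => c1 z + c2 z).
Proof.
move=> [M1 H1] [M2 H2]; exists (M1 + M2) => z Kz.
by rewrite (le_trans (ler_normD _ _))// lerD ?H1 ?H2.
Qed.

Lemma bounded_onZ (A : R) c : bounded_on K c -> bounded_on K (fun z => A * c z).
Proof.
by move=> [M H]; exists (`|A| * M) => z Kz; rewrite normrM ler_wpM2l// H.
Qed.

Lemma bounded_on_close c1 c2 (e : R) : bounded_on K c1 ->
  (forall z, K z -> `|c1 z - c2 z| <= e) -> bounded_on K c2.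
Proof.
move=> [M H] ce; exists (M + e) => z Kz.
have -> : c2 z = c1 z - (c1 z - c2 z) by ring.
by rewrite (le_trans (ler_normB _ _))// lerD ?H ?ce.
Qed.

Lemma bounded_on_wsum p n : bounded_on K (wsum p n).
Proof.
exists (\sum_(k < n) `|p k|) => z Kz; rewrite (le_trans (ler_norm_sum _ _ _))//.
by apply: ler_sum => k _; rewrite normrM (ger0_norm (g_ge0 _)) ler_piMr.
Qed.

Lemma bounded_on_eval f (t : R) : (exists M : R, forall w, `|f w| <= M) ->
  bounded_on K (fun z => f (z t)).
Proof. by move=> [M H]; exists M => z _. Qed.

Lemma V_bounded c : bounded_on K c -> exists M : R, forall w, `|V c w| <= M.
Proof. by case: HV => + _ _; exact. Qed.

(** Monotonicity applied to [c1 <= c2 + e], together with the commutation of [V] with constants,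
    makes [V] nonexpansive. With [e = 0], [V] depends only on the restriction of a cost to [K]. *)
Lemma V_dist c1 c2 (e : R) : bounded_on K c1 ->
  (forall z, K z -> `|c1 z - c2 z| <= e) -> forall w, `|V c1 w - V c2 w| <= e.
Proof.
move=> b1 ce w; have b2 := bounded_on_close b1 ce.
case: HV => _ aff mon.
have sh c : bounded_on K c -> forall B, V (fun z => 1 * c z + B) w = V c w + B.
  by move=> bc B; rewrite (aff _ _ _ bc ler01) mul1r.
have bs c B : bounded_on K c -> bounded_on K (fun z => 1 * c z + B).
  move=> [M H]; exists (M + `|B|) => z Kz; rewrite mul1r.
  by rewrite (le_trans (ler_normD _ _))// lerD2r H.
have H1 : V c1 w <= V c2 w + e.
  rewrite -sh//; apply: mon => //; first exact: bs.
  by move=> z /ce; rewrite ler_norml => /andP[_]; lra.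
have H2 : V c2 w <= V c1 w + e.
  rewrite -sh//; apply: mon => //; first exact: bs.
  by move=> z /ce; rewrite ler_norml => /andP[+ _]; lra.
by rewrite ler_norml; apply/andP; split; lra.
Qed.

Lemma eq_V c1 c2 : bounded_on K c1 -> (forall z, K z -> c1 z = c2 z) -> V c1 = V c2.
Proof.
move=> b1 e12; apply/funext => w; apply/eqP; rewrite -subr_eq0 -normr_le0.
by apply: V_dist => // z Kz; rewrite e12// subrr normr0.
Qed.

Lemma VZ (A : R) c w : bounded_on K c -> 0 <= A -> V (fun z => A * c z) w = A * V c w.
Proof.
move=> bc A0; case: HV => _ aff _.
have := aff _ _ 0 bc A0 => /(congr1 (@^~ w)); rewrite addr0 => <-.
by congr (V _ w); apply/funext => z; rewrite addr0.
Qed.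

Lemma V0 w : V (fun=> 0) w = 0.
Proof.
have b0 : bounded_on K (fun=> 0) by exists 0 => z _; rewrite normr0.
transitivity (V (fun z => 0 * (fun=> 0) z) w); last by rewrite VZ// mul0r.
by congr (V _ w); apply/funext => z; rewrite mulr0.
Qed.

Lemma wsumZ (c : R) p n z : wsum (fun k => c * p k) n z = c * wsum p n z.
Proof. by rewrite /wsum mulr_sumr; apply: eq_bigr => i _; rewrite mulrA. Qed.

Lemma wsum_dist p q n z : `|wsum p n z - wsum q n z| <= \sum_(k < n) `|p k - q k|.
Proof.
rewrite /wsum -sumrB (le_trans (ler_norm_sum _ _ _))//; apply: ler_sum => k _.
by rewrite -mulrBl normrM (ger0_norm (g_ge0 _)) ler_piMr.
Qed.

Lemma wsum_cat p (n N : nat) z : (n <= N)%N ->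
  wsum p N z = wsum p n z + \sum_(k < N - n) p (n + k)%N * g (z (n + k)%:R).
Proof.
exact: (sum_ord_cat (fun k => p k * g (z k%:R))).
Qed.

Section DensityCost.
Variable rho : R -> R.
Hypothesis rhoD : is_density rho.
Let rho0 t : 0 <= t -> 0 <= rho t. Proof. by case: rhoD => + _ _; exact. Qed.
Let mrho : lmeas Rp rho. Proof. by case: rhoD. Qed.

Lemma lint_running_cell z (k : nat) : K z ->
  lint `[k%:R, k.+1%:R[ (fun t => rho t * g (z t)) = (cells rho k * g (z k%:R))%:E.
Proof.
move=> Kz; rewrite (@eq_lint _ _ _ (fun t => g (z k%:R) * rho t)); last first.
  move=> t /=; rewrite in_itv/= => /andP[kt tk]; rewrite mulrC; congr (g _ * _).
  move: kt; rewrite le_eqVlt => /orP[/eqP->//|kt].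
  have -> : t = k%:R + (t - k%:R) by ring.
  by rewrite Hper// subr_gt0 kt ltrBlDl natr1.
rewrite lintZl//.
- by rewrite massE// -EFinM mulrC.
- by apply: lmeas_density => //; exact: sub_Rp.
- by move=> t /=; rewrite in_itv/= => /andP[kt _]; apply: rho0; exact: le_trans kt.
Qed.

Lemma running_ge0 z t : 0 <= t -> 0 <= rho t * g (z t).
Proof. by move=> t0; rewrite mulr_ge0// rho0. Qed.

Lemma lmeas_running z : K z -> lmeas Rp (fun t => rho t * g (z t)).
Proof. by move=> Kz; apply: lmeasM => //; exact: Hgm. Qed.

Lemma lint_running z n : K z ->
  lint `[0, n%:R[ (fun t => rho t * g (z t)) = (wsum (cells rho) n z)%:E.
Proof.
move=> Kz; rewrite lint_cells; last 2 first.
- exact: lmeas_running.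
- exact: running_ge0.
under eq_bigr do rewrite lint_running_cell//.
by rewrite sumEFin.
Qed.

(** As [0 <= g <= 1], the part of the integral beyond stage [n] lies between 0 and the tail mass. *)
Lemma cost_dist z n : K z -> `|cost g rho z - wsum (cells rho) n z| <= tailmass rho n%:R.
Proof.
move=> Kz; set T := lint `[n%:R, +oo[ (fun t => rho t * g (z t)).
have n0 : 0 <= n%:R :> R by [].
have T0 : (0 <= T)%E.
  apply: lint_ge0 => t /=; rewrite in_itv/= andbT => nt.
  by apply: running_ge0; exact: le_trans nt.
have T1 : (T <= (tailmass rho n%:R)%:E)%E.
  rewrite -tailmassE//; apply: le_lint.
  - exact: measurable_itv.
  - apply: lmeasS (lmeas_running Kz); first exact: measurable_itv.
    exact: sub_Rpy.
  - by apply: lmeas_density => //; exact: sub_Rpy.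
  - move=> t /=; rewrite in_itv/= andbT => nt.
    by apply: running_ge0; exact: le_trans nt.
  - move=> t /=; rewrite in_itv/= andbT => nt.
    by rewrite ler_piMr// rho0//; exact: le_trans nt.
have Tf : T \is a fin_num by rewrite ge0_fin_numE// (le_lt_trans T1)// ltry.
have -> : cost g rho z = wsum (cells rho) n z + fine T.
  rewrite /cost /Rp (@lint_itv_split _ _ _ 0 n%:R)//; last 2 first.
  - exact: lmeas_running.
  - exact: running_ge0.
  by rewrite lint_running// fineD.
by rewrite addrAC subrr add0r ger0_norm ?fine_ge0// -lee_fin fineK.
Qed.

Lemma bounded_on_cost : bounded_on K (cost g rho).
Proof.
apply: (@bounded_on_close (wsum (cells rho) 0) _ (tailmass rho 0)).
  exact: bounded_on_wsum.
by move=> z Kz; rewrite distrC; exact: (@cost_dist z 0).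
Qed.

Lemma dcostE z n : K z -> dcost g V rho n%:R z =
  wsum (cells rho) n z + tailmass rho n%:R * V (cost g (shift_dens rho n%:R)) (z n%:R).
Proof.
move=> Kz; rewrite /dcost lint_itvcc//; last 2 first.
- exact: lmeas_running.
- exact: running_ge0.
by rewrite lint_running.
Qed.

Lemma tailmass_cells n : tailmass rho n%:R = 1 - \sum_(k < n) cells rho k.
Proof.
rewrite -(mass_sum rhoD (x := fun k => k%:R))//.
  by rewrite mass_tail//; ring.
by move=> i j ij; rewrite ler_nat.
Qed.

Lemma cells_ge0 k : 0 <= cells rho k.
Proof. exact: mass_ge0. Qed.

End DensityCost.

Lemma eq_cost (r1 r2 : R -> R) z : (forall t, 0 <= t -> r1 t = r2 t) -> cost g r1 z = cost g r2 z.
Proof.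
move=> r12; rewrite /cost; congr fine; apply: eq_lint => t.
by rewrite /Rp/= in_itv/= andbT => t0; rewrite r12.
Qed.

Lemma eq_cost_fun (r1 r2 : R -> R) : (forall t, 0 <= t -> r1 t = r2 t) -> cost g r1 = cost g r2.
Proof. by move=> r12; apply/funext => z; exact: eq_cost. Qed.

Lemma cost_stepd p N z : K z -> (forall k, 0 <= p k) -> \sum_(k < N) p k = 1 ->
  cost g (stepd p N) z = wsum p N z.
Proof.
move=> Kz p0 p1; have D := stepd_density p0 p1.
have := cost_dist D N Kz; rewrite /tailmass stepd_tail//= normr_le0 subr_eq0 => /eqP->.
by apply: eq_bigr => k _; rewrite /cells mass_stepd ltn_ord.
Qed.

Definition J p (N : nat) := V (wsum p N).

Lemma eq_J p q N : (forall k, (k < N)%N -> p k = q k) -> J p N = J q N.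
Proof.
move=> pq; rewrite /J; congr V; apply/funext => z.
by apply: eq_bigr => k _; rewrite pq.
Qed.

Lemma JZ (c : R) p N w : 0 <= c -> J (fun k => c * p k) N w = c * J p N w.
Proof.
move=> c0; rewrite /J -VZ//; last exact: bounded_on_wsum.
by congr (V _ w); apply/funext => z; rewrite wsumZ.
Qed.

Let sumn0_eq0 p N : (forall k, 0 <= p k) -> \sum_(k < N) p k = 0 ->
  forall k, (k < N)%N -> p k = 0.
Proof.
move=> p0 /eqP; rewrite psumr_eq0// => /allP H k kN.
by apply/eqP; apply: (H (Ordinal kN)); rewrite mem_index_enum.
Qed.

(** This carries the principle from densities to nonnegative weights of any total mass: normalise to
    a step density, note that its shift is the normalised step density of the remaining weights, and
    undo both normalisations by homogeneity. *)
Lemma J_dp p (n N : nat) : (forall k, 0 <= p k) -> (0 < n <= N)%N ->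
  J p N = V (fun z => wsum p n z + J (fun k => p (n + k)%N) (N - n) (z n%:R)).
Proof.
move=> p0 /andP[n0 nN].
set P := \sum_(k < N) p k; set Q := \sum_(k < N - n) p (n + k)%N.
have PE : P = \sum_(k < n) p k + Q by exact: sum_ord_cat.
have S0 : 0 <= \sum_(k < n) p k by exact: sumr_ge0.
have : 0 <= Q by exact: sumr_ge0.
rewrite le_eqVlt => /orP[/eqP/esym Q0|Q0].
  have H k : (k < N - n)%N -> p (n + k)%N = 0 by exact: (@sumn0_eq0 (fun k => p (n + k)%N)).
  rewrite /J; apply: eq_V; first exact: bounded_on_wsum.
  move=> z Kz; rewrite (wsum_cat _ _ nN); congr (_ + _).
  rewrite big1; last by move=> k _; rewrite H// mul0r.
  rewrite -[LHS](V0 (z n%:R)); congr (V _ _); apply/funext => z'.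
  by rewrite /wsum big1// => k _; rewrite H// mul0r.
have P0 : 0 < P by rewrite PE; lra.
pose q k := P^-1 * p k.
have q0 k : 0 <= q k by rewrite mulr_ge0// invr_ge0 ltW.
have q1 : \sum_(k < N) q k = 1 by rewrite -mulr_sumr mulVf// gt_eqF.
have D := stepd_density q0 q1.
have qc k : (k < N)%N -> cells (stepd q N) k = q k by move=> kN; rewrite /cells mass_stepd kN.
have tm : tailmass (stepd q N) n%:R = P^-1 * Q.
  rewrite tailmass_cells//.
  under eq_bigr => k _ do rewrite qc ?(leq_trans (ltn_ord k))//.
  rewrite -mulr_sumr (_ : \sum_(k < n) p k = P - Q); last by rewrite PE addrK.
  by field; rewrite gt_eqF.
have dpp := HDPP D n0 _; rewrite tailmassE// tm lte_fin mulr_gt0 ?invr_gt0// in dpp.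
have {dpp} dpp := dpp isT.
pose r k := Q^-1 * p (n + k)%N.
have r0 k : 0 <= r k by rewrite mulr_ge0// invr_ge0 ltW.
have r1 : \sum_(k < N - n) r k = 1 by rewrite -mulr_sumr mulVf// gt_eqF.
have shE : cost g (shift_dens (stepd q N) n%:R) = cost g (stepd r (N - n)).
  apply: eq_cost_fun => t t0; rewrite /shift_dens tm stepd_shift// /q /r !stepdZ.
  by field; rewrite !gt_eqF.
have VshE : V (cost g (shift_dens (stepd q N) n%:R)) = J r (N - n).
  rewrite shE /J; apply: eq_V; last by move=> z Kz; exact: cost_stepd.
  by apply: bounded_on_cost; exact: stepd_density.
have JP w : J p N w = P * V (cost g (stepd q N)) w.
  rewrite (_ : V (cost g (stepd q N)) = J q N); last first.
    rewrite /J; apply: eq_V; last by move=> z Kz; exact: cost_stepd.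
    exact: bounded_on_cost.
  by rewrite -JZ 1?ltW//; congr (_ w); apply: eq_J => k _; rewrite /q mulrA divff ?mul1r// gt_eqF.
have dE z : K z -> dcost g V (stepd q N) n%:R z =
    P^-1 * (wsum p n z + J (fun k => p (n + k)%N) (N - n) (z n%:R)).
  move=> Kz; rewrite dcostE// tm VshE JZ; last by rewrite invr_ge0 ltW.
  rewrite (_ : wsum _ n z = P^-1 * wsum p n z).
    by field; rewrite !gt_eqF.
  rewrite -wsumZ; apply: eq_bigr => k _.
  by rewrite qc ?(leq_trans (ltn_ord k)).
have bd : bounded_on K (fun z => wsum p n z + J (fun k => p (n + k)%N) (N - n) (z n%:R)).
  apply: bounded_onD; first exact: bounded_on_wsum.
  by apply: bounded_on_eval; apply: V_bounded; exact: bounded_on_wsum.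
apply/funext => w; rewrite JP -dpp (eq_V (c2 := fun z => P^-1 *
  (wsum p n z + J (fun k => p (n + k)%N) (N - n) (z n%:R)))).
- by rewrite VZ// ?invr_ge0 ?(ltW P0)// mulrA divff ?mul1r// gt_eqF.
- by apply: (bounded_on_close (bounded_onZ P^-1 bd) (e := 0)) => z Kz; rewrite dE// subrr normr0.
- exact: dE.
Qed.

Lemma J_dist p q N (e : R) : \sum_(k < N) `|p k - q k| <= e ->
  forall w, `|J p N w - J q N w| <= e.
Proof.
move=> H; apply: V_dist; first exact: bounded_on_wsum.
by move=> z _; exact: le_trans (wsum_dist _ _ _ _) H.
Qed.

(** * Blocks of constant weights with a terminal reward *)

Section Tauber.
Variable U : Omega -> R.
Hypothesis HU : forall w, 0 <= U w <= 1.

Let U_norm w : `|U w| <= 1.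
Proof. by case/andP: (HU w) => U0 U1; rewrite ger0_norm. Qed.

Let U_mul (a : R) w : `|a * U w| <= `|a|.
Proof. by rewrite normrM ler_piMr. Qed.

Definition ev (n : nat) (C : R) :=
  V (fun z => wsum (fun=> 1) n z + C * U (z n%:R)).

Let bounded_term p (n : nat) (C : R) : bounded_on K (fun z => wsum p n z + C * U (z n%:R)).
Proof.
apply: bounded_onD; first exact: bounded_on_wsum.
by apply: bounded_onZ; apply: bounded_on_eval; exists 1.
Qed.

Let bounded_J p (n : nat) q N : bounded_on K (fun z => wsum p n z + J q N (z n%:R)).
Proof.
apply: bounded_onD; first exact: bounded_on_wsum.
by apply: bounded_on_eval; apply: V_bounded; exact: bounded_on_wsum.
Qed.

Lemma J_le p N w : `|J p N w| <= \sum_(k < N) `|p k|.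
Proof.
have H : \sum_(k < N) `|p k - 0| <= \sum_(k < N) `|p k|.
  by apply: ler_sum => k _; rewrite subr0.
have := @J_dist p (fun=> 0) N _ H w; rewrite (_ : J (fun=> 0) N w = 0) ?subr0//.
rewrite -[RHS](V0 w); congr (V _ w); apply/funext => z.
by rewrite /wsum big1// => k _; rewrite mul0r.
Qed.

Lemma J1_len (n N : nat) w : (n <= N)%N ->
  `|J (fun=> 1) N w - J (fun=> 1) n w| <= (N - n)%:R.
Proof.
move=> nN; apply: V_dist; first exact: bounded_on_wsum.
move=> z _; rewrite (wsum_cat _ _ nN) addrAC subrr add0r.
rewrite (le_trans (ler_norm_sum _ _ _))//.
have -> : (N - n)%:R = \sum_(k < N - n) (1 : R) by rewrite sumr_const card_ord.
by apply: ler_sum => k _; rewrite mul1r ger0_norm.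
Qed.

(** An additive constant replaces the threshold on [n], so that the bound covers short runs too;
    after multiplication by a small weight the constant is negligible. *)
Definition cesaro_bound := forall e : R, 0 < e -> exists2 A : R, 0 <= A &
  forall (n : nat) w, `|J (fun=> 1) n w - n%:R * U w| <= e * n%:R + A.

Definition block_bound (e A : R) := forall (n : nat) (C : R) w, (0 < n)%N -> 0 <= C ->
  `|ev n C w - (n%:R + C) * U w| <= e * (n%:R + C) + A.

Lemma J1_dp (n M : nat) : (0 < n)%N ->
  J (fun=> 1) (n + M) = V (fun z => wsum (fun=> 1) n z + J (fun=> 1) M (z n%:R)).
Proof.
move=> n0; rewrite (@J_dp _ n (n + M)) ?n0 ?leq_addr//.
by rewrite addKn.
Qed.

(** The reward [C U] is replaced by the value of [M] unit weights, [M] being the integer part of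
    [C], and dynamic programming merges these with the block into [n + M] unit weights. The Cesaro
    bound is used for [M] and for [n + M], and rounding [C] costs at most 1 each time: hence
    [2 A + 2]. *)
Lemma cesaro_block : cesaro_bound -> forall e : R, 0 < e -> exists2 A : R, 0 <= A & block_bound e A.
Proof.
move=> ces e e0; have [|A A0 HA] := ces (e / 2); first by lra.
exists (2 * A + 2); first by lra.
move=> n C w n0 C0; set M := Num.truncn C.
have /andP[M1 M2] : M%:R <= C < M.+1%:R by exact: truncn_itv.
rewrite -natr1 in M2.
have d1 : `|ev n C w - J (fun=> 1) (n + M) w| <= 1 + e / 2 * C + A.
  rewrite J1_dp//; apply: V_dist; first exact: bounded_term.
  move=> z Kz; rewrite opprD addrACA subrr add0r.
  have -> : C * U (z n%:R) - J (fun=> 1) M (z n%:R) =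
    (C - M%:R) * U (z n%:R) - (J (fun=> 1) M (z n%:R) - M%:R * U (z n%:R)) by ring.
  rewrite (le_trans (ler_normB _ _))// -addrA lerD//.
    by rewrite (le_trans (U_mul _ _))// ger0_norm; lra.
  by rewrite (le_trans (HA _ _))// lerD2r ler_wpM2l//; lra.
have d2 := HA (n + M)%N w.
have d3 : `|(C - M%:R) * U w| <= 1 by rewrite (le_trans (U_mul _ _))// ger0_norm; lra.
have -> : ev n C w - (n%:R + C) * U w = (ev n C w - J (fun=> 1) (n + M) w) +
  ((J (fun=> 1) (n + M) w - (n + M)%:R * U w) - (C - M%:R) * U w) by rewrite natrD; ring.
rewrite (le_trans (ler_normD _ _))//.
have := ler_normB (J (fun=> 1) (n + M) w - (n + M)%:R * U w) ((C - M%:R) * U w).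
have : e / 2 * M%:R <= e / 2 * C by rewrite ler_wpM2l//; lra.
have : 0 <= e * n%:R by rewrite mulr_ge0// ltW.
move: d2; rewrite natrD; lra.
Qed.

(** The first [n] weights are replaced by [h] and the continuation by [T U], with [T] the remaining
    mass; homogeneity turns the result into [h] times [ev n (T / h)]. The L1 distance to [h] is paid
    twice, once in the payoff and once in the total mass multiplying [U]. *)
Lemma block_step p (n N : nat) (h d e A : R) : block_bound e A -> (forall k, 0 <= p k) ->
  (0 < n <= N)%N -> 0 < h ->
  (forall w, `|J (fun k => p (n + k)%N) (N - n) w - (\sum_(k < N - n) p (n + k)%N) * U w| <= d) ->
  forall w, `|J p N w - (\sum_(k < N) p k) * U w| <=
    d + 2 * (\sum_(k < n) `|p k - h|) + e * (h * n%:R + \sum_(k < N - n) p (n + k)%N) + h * A.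
Proof.
move=> blk p0 /andP[n0 nN] h0 Hd w.
rewrite (sum_ord_cat p nN).
set T := \sum_(k < N - n) p (n + k)%N; set S := \sum_(k < n) `|p k - h|.
have T0 : 0 <= T by exact: sumr_ge0.
have d1 : `|J p N w - h * ev n (T / h) w| <= S + d.
  have -> : h * ev n (T / h) w = V (fun z => h * (wsum (fun=> 1) n z + T / h * U (z n%:R))) w.
    by rewrite /ev VZ//; first [exact: bounded_term|exact: ltW].
  rewrite (@J_dp p n N) ?n0//; apply: V_dist; first exact: bounded_J.
  move=> z Kz; rewrite mulrDr -wsumZ.
  have -> : h * (T / h * U (z n%:R)) = T * U (z n%:R) by field; rewrite gt_eqF.
  rewrite opprD addrACA (le_trans (ler_normD _ _))// lerD//.
  rewrite (le_trans (wsum_dist _ _ _ _))//; apply: ler_sum => k _.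
  by rewrite mulr1.
have d2 := blk n (T / h) w n0 (divr_ge0 T0 (ltW h0)).
have d3 : `|(\sum_(k < n) p k - h * n%:R) * U w| <= S.
  rewrite (le_trans (U_mul _ _))//.
  have -> : h * n%:R = \sum_(k < n) h by rewrite sumr_const card_ord mulr_natr.
  by rewrite -sumrB ler_norm_sum.
have d4 : `|h * (ev n (T / h) w - (n%:R + T / h) * U w)| <= e * (h * n%:R + T) + h * A.
  rewrite normrM (gtr0_norm h0) (_ : _ + h * A = h * (e * (n%:R + T / h) + A)).
    by rewrite ler_wpM2l// ltW.
  by field; rewrite gt_eqF.
have -> : J p N w - (\sum_(k < n) p k + T) * U w = (J p N w - h * ev n (T / h) w) +
  (h * (ev n (T / h) w - (n%:R + T / h) * U w) - (\sum_(k < n) p k - h * n%:R) * U w).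
  by field; rewrite gt_eqF.
rewrite (le_trans (ler_normD _ _))//.
have := ler_normB (h * (ev n (T / h) w - (n%:R + T / h) * U w)) ((\sum_(k < n) p k - h * n%:R) * U w).
lra.
Qed.

(** The exponent 2 matters: a chain of order [1 / kappa] blocks then has total error of order
    [kappa]. *)
Definition small_blocks (D : R) := forall kappa : R, 0 < kappa <= 1 -> exists2 A0 : R, 0 < A0 &
  forall (C : R) (n : nat) w, A0 <= C -> (0 < n)%N -> n%:R <= kappa * C ->
  `|ev n C w - (n%:R + C) * U w| <= D * kappa ^+ 2 * C.

(* The constant weights [1] on [n] stages are cut into about [2 / (kappa delta)] blocks; a fictitious
   terminal reward [delta n U] keeps every block short with respect to what follows it. *)
Lemma small_blocks_cesaro (D : R) : 0 <= D -> small_blocks D -> forall e : R, 0 < e ->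
  exists N0 : nat, forall n : nat, (N0 <= n)%N -> forall w,
    `|J (fun=> 1) n w - n%:R * U w| <= e * n%:R.
Proof.
move=> D0 sb e e0.
pose del := Num.min e 1 / 8.
have [del0 del1 dele] : [/\ 0 < del, del <= 1 & 5 * del <= e].
  rewrite /del; split.
  - by rewrite divr_gt0// lt_min e0 ltr01.
  - by rewrite ler_pdivrMr// mul1r ge_min; apply/orP; right; lra.
  - have : Num.min e 1 <= e by rewrite ge_min lexx.
    by lra.
(* At most [2 / (kap del)] blocks, each with error [D kap^2 (2 n)], give [4 D kap n / del], which is
   at most [del n] for this [kap]. *)
pose kap := del ^+ 2 / (4 * (D + 1)).
have D1 : 0 < 4 * (D + 1) by lra.
have kap0 : 0 < kap by rewrite divr_gt0// exprn_gt0.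
have kap1 : kap <= 1.
  by rewrite ler_pdivrMr// mul1r expr2; nra.
have kapE : 4 * D * kap <= del ^+ 2.
  have : kap * (4 * (D + 1)) = del ^+ 2 by rewrite /kap divfK// gt_eqF.
  by lra.
have [A0 A00 HA] : exists2 A0 : R, 0 < A0 & forall (C : R) (n : nat) w, A0 <= C -> (0 < n)%N ->
    n%:R <= kap * C -> `|ev n C w - (n%:R + C) * U w| <= D * kap ^+ 2 * C.
  by apply: sb; rewrite kap0.
(* The first summand puts the reward [del n] above the threshold [A0]; the second makes
   [kap del n >= 2], so that its integer part [eta] is at least half of it. *)
exists (Num.truncn (A0 / del + 2 / (kap * del))).+1 => n nN w.
have kd0 : 0 < kap * del by rewrite mulr_gt0.
have nn : A0 / del + 2 / (kap * del) <= n%:R.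
  by rewrite (le_trans (ltW (truncnS_gt _)))// ler_nat.
have q1 : 0 < A0 / del by rewrite divr_gt0.
have q2 : 0 < 2 / (kap * del) by rewrite divr_gt0.
have n1 : A0 <= del * n%:R by rewrite mulrC -ler_pdivrMr//; lra.
have n2 : 2 <= kap * del * n%:R by rewrite mulrC -ler_pdivrMr//; lra.
set nr : R := n%:R in n1 n2 *.
have nr0 : 0 < nr by rewrite /nr; move: nn; lra.
pose eta := Num.truncn (kap * del * nr).
have /andP[eta1 eta2] : eta%:R <= kap * del * nr < eta.+1%:R by apply: truncn_itv; lra.
rewrite -natr1 in eta2.
have eta0 : (0 < eta)%N by rewrite /eta truncn_gt0; lra.
have eta3 : kap * del * nr <= 2 * eta%:R by lra.
(* Induction on the number of blocks still to play: the value of the later blocks serves as terminal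
   reward with [C = j eta + del n]. The fictitious [del n] is charged once, at [j = 0]. *)
have claim j : (j * eta <= n)%N -> forall w, `|J (fun=> 1) (j * eta) w - ((j * eta)%:R + del * nr) * U w|
    <= del * nr + j%:R * (D * kap ^+ 2 * (2 * nr)).
  elim: j => [|j IH] jn w'.
    rewrite mul0n mul0r addr0 (_ : J _ 0 w' = 0); last first.
      by rewrite -[RHS](V0 w'); congr (V _ w'); apply/funext => z; rewrite /wsum big_ord0.
    by rewrite sub0r normrN add0r (le_trans (U_mul _ _))// ger0_norm// mulr_ge0// ltW.
  have jn' : (j * eta <= n)%N by apply: leq_trans jn; rewrite leq_mul2r leqnSn orbT.
  have jr : (j * eta)%:R <= nr by rewrite ler_nat.
  have je0 : 0 <= (j * eta)%:R :> R by [].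
  rewrite mulSn J1_dp//.
  set C := (j * eta)%:R + del * nr.
  have C1 : A0 <= C by rewrite /C; lra.
  have C2 : C <= 2 * nr by rewrite /C; nra.
  have C3 : eta%:R <= kap * C.
    rewrite (le_trans eta1)// -mulrA ler_pM2l// /C; lra.
  have d1 : `|V (fun z => wsum (fun=> 1) eta z + J (fun=> 1) (j * eta) (z eta%:R)) w' - ev eta C w'|
     <= del * nr + j%:R * (D * kap ^+ 2 * (2 * nr)).
    apply: V_dist; first exact: bounded_J.
    by move=> z Kz; rewrite opprD addrACA subrr add0r; exact: IH.
  have d2 := HA C eta w' C1 eta0 C3.
  have d3 : D * kap ^+ 2 * C <= D * kap ^+ 2 * (2 * nr) by rewrite ler_wpM2l// mulr_ge0// sqr_ge0.
  have -> : (eta + j * eta)%:R + del * nr = eta%:R + C by rewrite natrD /C; ring.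
  set X := D * kap ^+ 2 * (2 * nr) in d1 d3 *.
  have -> : del * nr + j.+1%:R * X = (del * nr + j%:R * X) + X by rewrite -natr1; ring.
  rewrite (le_trans (ler_distD (ev eta C w') _ _))// lerD//.
  exact: le_trans d2 d3.
pose j := (n %/ eta)%N.
have jn : (j * eta <= n)%N by exact: leq_trunc_div.
have nj : (n - j * eta)%:R <= del * nr.
  have : (n - j * eta <= eta)%N by rewrite leq_subLR /j {1}(divn_eq n eta) leq_add2l ltnW// ltn_pmod.
  rewrite -(ler_nat R) => /le_trans; apply; apply: (le_trans eta1).
  by rewrite -mulrA ler_piMl// mulr_ge0// ltW.
have cj := claim j jn w.
have jb : j%:R * (D * kap ^+ 2 * (2 * nr)) <= del * nr.
  have jr : j%:R * eta%:R <= nr by rewrite -natrM ler_nat.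
  have j0 : 0 <= j%:R :> R by [].
  have jk : j%:R * (kap * del) <= 2.
    have : j%:R * (kap * del * nr) <= 2 * nr.
      rewrite (le_trans (ler_wpM2l j0 eta3))//; lra.
    by rewrite mulrA ler_pM2r.
  have E1 : j%:R * (D * kap ^+ 2 * (2 * nr)) * del = (j%:R * (kap * del)) * (2 * D * kap * nr) by ring.
  rewrite -(ler_pM2r del0) E1.
  have E2 : 0 <= 2 * D * kap * nr by apply: mulr_ge0; [apply: mulr_ge0; [apply: mulr_ge0|]|]; lra.
  rewrite (le_trans (ler_wpM2r E2 jk))//.
  have -> : 2 * (2 * D * kap * nr) = (4 * D * kap) * nr by ring.
  have -> : del * nr * del = del ^+ 2 * nr by ring.
  by rewrite ler_pM2r.
have d1 := J1_len w jn.
have nE : nr = (n - j * eta)%:R + (j * eta)%:R by rewrite -natrD subnK.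
have d2 : `|((j * eta)%:R + del * nr - nr) * U w| <= 2 * (del * nr).
  rewrite (le_trans (U_mul _ _))// {2}nE ler_norml.
  have : 0 <= (n - j * eta)%:R :> R by [].
  have : 0 <= del * nr by rewrite mulr_ge0// ltW.
  by move=> x1 x2; apply/andP; split; lra.
have -> : J (fun=> 1) n w - nr * U w = (J (fun=> 1) n w - J (fun=> 1) (j * eta) w) +
  ((J (fun=> 1) (j * eta) w - ((j * eta)%:R + del * nr) * U w) + ((j * eta)%:R + del * nr - nr) * U w) by ring.
rewrite (le_trans (ler_normD _ _))//.
have := ler_normD (J (fun=> 1) (j * eta) w - ((j * eta)%:R + del * nr) * U w) (((j * eta)%:R + del * nr - nr) * U w).
have : 5 * del * nr <= e * nr by rewrite ler_wpM2r// ltW.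
lra.
Qed.

(* Dynamic programming for the scaled density reproduces the constant weights up to [O(n^2 / S)]
   while keeping a terminal reward of the same shape, because the family of scalings is stable under shifts. *)
Lemma selfsimilar_small_blocks (f : R -> R) (f0 L : R) : is_density f -> 0 < f0 -> 0 <= L ->
  (forall t, 0 <= t -> f t <= f0) -> (forall t, 0 <= t -> f0 * (1 - L * t) <= f t) ->
  (forall r, 0 <= r -> exists s c : R, [/\ 0 < s <= 1, 0 < c & forall t, 0 <= t -> f (r + t) = c * f (s * t)]) ->
  (forall e : R, 0 < e -> exists2 l0 : R, 0 < l0 & forall l, 0 < l < l0 -> forall w,
     `|V (cost g (scale_dens f l)) w - U w| <= e) ->
  small_blocks (2 * (L / f0) + 4).
Proof.
move=> fD f00 L0 fle fge fss conv kap /andP[kap0 kap1].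
have [|l0 l00 Hl] := conv (kap ^+ 2); first by rewrite exprn_gt0.
have fl0 : 0 < f0 * l0 by rewrite mulr_gt0.
(* This makes the scale [l = 1 / (f0 S)] fall below [l0], since [S > C]. *)
exists ((f0 * l0)^-1); first by rewrite invr_gt0.
move=> C n w CA n0 nk.
have C0 : 0 < C by apply: lt_le_trans CA; rewrite invr_gt0.
have n1 : 0 < n%:R :> R by rewrite ltr0n.
set S := n%:R + C; have S0 : 0 < S by rewrite /S; lra.
(* With this scale, [S] times the scaled density has height 1 at time 0, so its first cells have
   weights close to 1. *)
pose l := (f0 * S)^-1; have l1 : 0 < l by rewrite invr_gt0 mulr_gt0.
have ll0 : l < l0.
  rewrite /l invf_plt ?posrE ?mulr_gt0//.
  have : (f0 * l0)^-1 < S by rewrite /S; lra.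
  rewrite invfM mulrC ltr_pdivrMr// mulrC; by [].
pose rho := scale_dens f l.
have rD : is_density rho by exact: scale_density.
have [s [c [/andP[s0 s1] c0 Hs]]] := fss (l * n%:R) (mulr_ge0 (ltW l1) (ltW n1)).
have shE : cost g (shift_dens rho n%:R) = cost g (scale_dens f (s * l)).
  apply: eq_cost_fun => t t0.
  rewrite (@shift_selfsimilar _ rho n%:R s c)//; last first.
    by move=> u u0; rewrite /rho /scale_dens mulrDr Hs ?mulr_ge0 ?(ltW l1)// mulrCA; congr (_ * (_ * f _)); ring.
  by rewrite /rho /scale_dens mulrA; congr (_ * f _); ring.
have e1 : forall w, `|V (cost g rho) w - U w| <= kap ^+ 2 by apply: Hl; rewrite l1.
have e2 : forall w, `|V (cost g (shift_dens rho n%:R)) w - U w| <= kap ^+ 2.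
  (* Since [s <= 1], the scale [s l] of the shifted density is still below [l0]. *)
  by rewrite shE; apply: Hl; rewrite mulr_gt0//= (le_lt_trans _ ll0)// ler_piMl// ltW.
(* This bounds the relative drop of the density over the first [n] cells. *)
pose th := L * l * n%:R.
have th0 : 0 <= th by rewrite !mulr_ge0// ltW.
have lS : l * f0 * S = 1 by rewrite /l; field; rewrite !gt_eqF.
have cb k : (k < n)%N -> 1 - th <= S * cells rho k <= 1.
  move=> kn; have k1 : k%:R <= k.+1%:R :> R by rewrite ler_nat.
  have kd : k.+1%:R - k%:R = 1 :> R by rewrite -natr1 addrAC subrr add0r.
  apply/andP; split.
    have : l * f0 * (1 - th) * (k.+1%:R - k%:R) <= cells rho k.
      apply: ge_mass => // t /andP[kt tk]; have t0 : 0 <= t by exact: le_trans kt.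
      rewrite /rho /scale_dens -mulrA ler_pM2l//.
      apply: (le_trans _ (fge _ (mulr_ge0 (ltW l1) t0))); rewrite ler_pM2l// lerD2l lerN2.
      rewrite /th -mulrA ler_wpM2l// ler_pM2l// ltW// (lt_le_trans tk)// ler_nat//.
    rewrite kd mulr1 -(ler_pM2l S0).
    have -> : S * (l * f0 * (1 - th)) = (l * f0 * S) * (1 - th) by ring.
    by rewrite lS mul1r.
  have : cells rho k <= l * f0 * (k.+1%:R - k%:R).
    apply: le_mass => // t /andP[kt tk]; have t0 : 0 <= t by exact: le_trans kt.
    by rewrite /rho /scale_dens ler_pM2l// fle// mulr_ge0// ltW.
  rewrite kd mulr1 -(ler_pM2l S0).
  by have -> : S * (l * f0) = 1 by rewrite -[RHS]lS; ring.
have sb : \sum_(k < n) `|S * cells rho k - 1| <= n%:R * th.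
  have -> : n%:R * th = \sum_(k < n) th by rewrite sumr_const card_ord mulr_natl.
  apply: ler_sum => k _; have /andP[k1 k2] := cb k (ltn_ord k).
  by rewrite ler_norml; apply/andP; split; lra.
have tE : S * tailmass rho n%:R = C + (n%:R - \sum_(k < n) S * cells rho k).
  by rewrite tailmass_cells// mulrBr mulr1 mulr_sumr /S; ring.
have tb : 0 <= n%:R - \sum_(k < n) S * cells rho k <= n%:R * th.
  have -> : n%:R - \sum_(k < n) S * cells rho k = \sum_(k < n) (1 - S * cells rho k).
    by rewrite sumrB sumr_const card_ord.
  apply/andP; split.
    by apply: sumr_ge0 => k _; have /andP[k1 k2] := cb k (ltn_ord k); lra.
  have -> : n%:R * th = \sum_(k < n) th by rewrite sumr_const card_ord mulr_natl.
  by apply: ler_sum => k _; have /andP[k1 k2] := cb k (ltn_ord k); lra.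
have t0 : 0 < tailmass rho n%:R.
  by rewrite -(pmulr_rgt0 _ S0) tE; case/andP: tb; lra.
have t1 : tailmass rho n%:R <= 1.
  by rewrite tailmass_cells// gerBl sumr_ge0// => k _; exact: cells_ge0.
have dpp : V (dcost g V rho n%:R) = V (cost g rho).
  by apply: HDPP => //; rewrite tailmassE// lte_fin.
have bd : bounded_on K (dcost g V rho n%:R).
  apply: (bounded_on_close (e := 0) (c1 := fun z => wsum (cells rho) n z +
    tailmass rho n%:R * V (cost g (shift_dens rho n%:R)) (z n%:R))).
    apply: bounded_onD; first exact: bounded_on_wsum.
    apply: bounded_onZ; apply: bounded_on_eval; apply: V_bounded; rewrite shE.
    by apply: bounded_on_cost; apply: scale_density => //; rewrite mulr_gt0.
  by move=> z Kz; rewrite dcostE// subrr normr0.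
(* One [n th] comes from the weights, one from the mass they lack, which passes to the tail, and
   [S kap^2] from the continuation value; [d2] adds another [S kap^2]. With
   [n th <= (L / f0) kap^2 C] and [S <= 2 C] this yields the constant [2 (L / f0) + 4]. *)
have d1 : `|S * V (cost g rho) w - ev n C w| <= 2 * (n%:R * th) + S * kap ^+ 2.
  rewrite -dpp -VZ ?(ltW S0)//; apply: V_dist; first exact: bounded_onZ.
  move=> z Kz; rewrite dcostE// mulrDr -wsumZ mulrA tE.
  set v := V _ _; set D := n%:R - _ in tb tE *.
  have -> : wsum (fun k => S * cells rho k) n z + (C + D) * v - (wsum (fun=> 1) n z + C * U (z n%:R)) =
    (wsum (fun k => S * cells rho k) n z - wsum (fun=> 1) n z) +
    ((C + D) * (v - U (z n%:R)) + D * U (z n%:R)) by ring.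
  rewrite (le_trans (ler_normD _ _))//.
  have w1 := le_trans (wsum_dist (fun k => S * cells rho k) (fun=> 1) n z) sb.
  have w2 : `|D * U (z n%:R)| <= n%:R * th.
    by rewrite (le_trans (U_mul _ _))// ger0_norm; case/andP: tb.
  have w3 : `|(C + D) * (v - U (z n%:R))| <= S * kap ^+ 2.
    rewrite normrM -tE ger0_norm ?mulr_ge0 ?(ltW S0) ?(ltW t0)//.
    apply: ler_pM => //; first by rewrite mulr_ge0 ?(ltW S0) ?(ltW t0).
    - by rewrite ler_piMr// ltW.
    - exact: e2.
  have := ler_normD ((C + D) * (v - U (z n%:R))) (D * U (z n%:R)); lra.
have d2 : `|S * V (cost g rho) w - S * U w| <= S * kap ^+ 2.
  by rewrite -mulrBr normrM gtr0_norm// ler_pM2l// e1.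
have nth : n%:R * th <= (L / f0) * kap ^+ 2 * C.
  have -> : n%:R * th = (L / f0) * (n%:R ^+ 2 / S).
    by rewrite /th /l; field; rewrite !gt_eqF.
  rewrite -(mulrA (L / f0)) ler_wpM2l ?divr_ge0// ?(ltW f00)// ler_pdivrMr//.
  have : n%:R ^+ 2 <= (kap * C) ^+ 2 by rewrite lerXn2r ?nnegrE ?mulr_ge0// ltW.
  have : kap ^+ 2 * C * C <= kap ^+ 2 * C * S.
    by rewrite ler_wpM2l ?mulr_ge0 ?sqr_ge0 ?(ltW C0)// /S; lra.
  rewrite (_ : (kap * C) ^+ 2 = kap ^+ 2 * C * C); last by ring.
  lra.
have SC : S * kap ^+ 2 <= 2 * kap ^+ 2 * C.
  have : S <= 2 * C.
    have : kap * C <= C by rewrite ler_piMl// ltW.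
    by rewrite /S; lra.
  have k2 : 0 <= kap ^+ 2 by exact: sqr_ge0.
  move=> /(ler_wpM2r k2); lra.
rewrite distrC in d1.
rewrite (le_trans (ler_distD (S * V (cost g rho) w) _ _))//.
have -> : (2 * (L / f0) + 4) * kap ^+ 2 * C = 2 * ((L / f0) * kap ^+ 2 * C) + 4 * (kap ^+ 2 * C) by ring.
lra.
Qed.

End Tauber.

(** * From Cesaro convergence to scalings of a piecewise continuous density *)

Section ScaleLimit.
Variable U : Omega -> R.
Hypothesis HU : forall w, 0 <= U w <= 1.
Hypothesis ces : cesaro_bound U.
Variable mu : R -> R.
Hypothesis muD : is_density mu.
Variable b : R.
Hypothesis b0 : 0 < b.

(** Under scale [l], a cell occupies length [l] on the time axis of [mu], and [stage l x] is the
    index of the cell containing [x]. *)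
Let stage (l x : R) := Num.truncn (x / l).
Let pl (l : R) := cells (scale_dens mu l).

(** The slack [eta] absorbs whatever vanishes with [l], so [B] records only the errors that persist
    in the limit. *)
Definition stage_bound (x B : R) := forall eta : R, 0 < eta -> exists2 l0 : R, 0 < l0 &
  forall l, 0 < l < l0 -> forall w,
  `|J (fun k => pl l (stage l x + k)%N) (stage l b - stage l x) w -
    (\sum_(k < stage l b - stage l x) pl l (stage l x + k)%N) * U w| <= B + eta.

Definition cells_close (x y h D : R) := forall eta : R, 0 < eta -> exists2 l0 : R, 0 < l0 &
  forall l, 0 < l < l0 ->
  \sum_(k < stage l y - stage l x) `|pl l (stage l x + k)%N - l * h| <= D + eta.

Let pl_ge0 l k : 0 < l -> 0 <= pl l k.
Proof. by move=> l0; apply: cells_ge0; exact: scale_density. Qed.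

Let plE l k : 0 < l -> pl l k = mass mu (l * k%:R) (l * k.+1%:R).
Proof. by move=> l0; rewrite /pl /cells mass_scale. Qed.

Let stageP l x : 0 < l -> 0 <= x -> l * (stage l x)%:R <= x < l * (stage l x)%:R + l.
Proof.
move=> l0 x0; have : 0 <= x / l by rewrite divr_ge0// ltW.
move=> /truncn_itv; rewrite -/(stage l x) -natr1 ler_pdivlMr// ltr_pdivrMr// mulrDl mul1r.
by rewrite [l * _]mulrC.
Qed.

Let stage_le l x y : 0 < l -> x <= y -> (stage l x <= stage l y)%N.
Proof. by move=> l0 xy; apply: le_truncn; rewrite ler_pM2r ?invr_gt0. Qed.

Let sum_pl_le1 l j N : 0 < l -> \sum_(k < N) pl l (j + k)%N <= 1.
Proof.
move=> l0; have D := scale_density l0 muD.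
have := tailmass_cells D (j + N); have := tailmass_ge0 D (ler0n R (j + N)).
rewrite (@sum_ord_cat _ _ j (j + N)) ?leq_addr// addKn -/(pl l).
have : 0 <= \sum_(k < j) pl l k by apply: sumr_ge0 => k _; exact: pl_ge0.
lra.
Qed.

(** [block_step] is used with height [l h]. Its additive term becomes [l h A], where [A] depends on
    [e1] only and hence is fixed before [l] tends to 0; only [2 D] survives. *)
Lemma stage_step (x y h B D : R) : 0 <= x -> x <= y -> y <= b -> 0 < h -> 0 <= D ->
  cells_close x y h D -> stage_bound y B -> stage_bound x (B + 2 * D).
Proof.
move=> x0 xy yb h0 D0 cc sy eta eta0.
have y0 := le_trans x0 xy.
(* The relative error multiplies the constant block mass, at most [h b], plus the remaining mass, at
   most 1. *)
pose e1 := eta / 4 / (h * b + 1).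
have hb : 0 < h * b + 1 by rewrite addr_gt0// mulr_gt0.
have e10 : 0 < e1 by rewrite !divr_gt0.
have [A A0 blk] := cesaro_block HU ces e10.
have [|la la0 Ha] := sy (eta / 4); first by lra.
have [|lb lb0 Hb] := cc (eta / 8); first by lra.
have hA : 0 < h * A + 1 by rewrite ltr_wpDl// mulr_ge0// ltW.
exists (Num.min (Num.min la lb) (eta / 4 / (h * A + 1))).
  by rewrite !lt_min la0 lb0 !divr_gt0.
move=> l /andP[l0]; rewrite !lt_min => /andP[/andP[lla llb] llc] w.
have {}Ha := Ha l (introT andP (conj l0 lla)).
have {}Hb := Hb l (introT andP (conj l0 llb)).
have sxy := stage_le l0 xy; have syb := stage_le l0 yb.
have sE : (stage l x + (stage l y - stage l x) = stage l y)%N by rewrite subnKC.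
have [n0|n0] := posnP (stage l y - stage l x)%N.
  have <- : stage l y = stage l x by rewrite -sE n0 addn0.
  by apply: (le_trans (Ha w)); lra.
pose p k := pl l (stage l x + k)%N.
have pE k : p (stage l y - stage l x + k)%N = pl l (stage l y + k)%N by rewrite /p addnA sE.
have NE : (stage l b - stage l x - (stage l y - stage l x) = stage l b - stage l y)%N.
  by rewrite -subnDA sE.
have := @block_step U HU p (stage l y - stage l x) (stage l b - stage l x) (l * h) (B + eta / 4) e1 A blk.
rewrite NE (_ : (fun k => p (stage l y - stage l x + k)%N) = (fun k => pl l (stage l y + k)%N)); last exact/funext.
under eq_bigr do rewrite pE.
move=> /(_ (fun k => pl_ge0 _ l0)); rewrite n0 leq_sub2r// mulr_gt0// => /(_ isT isT Ha w) H.
apply: (le_trans H).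
have T1 := sum_pl_le1 (stage l y) (stage l b - stage l y) l0.
have ln : l * (stage l y - stage l x)%:R <= b.
  have /andP[yl _] := stageP l0 y0.
  rewrite (le_trans _ yb)// (le_trans _ yl)// ler_pM2l// ler_nat leq_subr//.
have t1 : e1 * (l * h * (stage l y - stage l x)%:R +
    \sum_(k < stage l b - stage l y) pl l (stage l y + k)%N) <= eta / 4.
  rewrite [leRHS](_ : _ = e1 * (h * b + 1)); last by rewrite /e1 divfK// gt_eqF.
  rewrite ler_pM2l// lerD// [l * h]mulrC -mulrA ler_pM2l//.
have t2 : l * h * A <= eta / 4.
  by move: llc; rewrite ltr_pdivlMr//; lra.
rewrite -/p in Hb.
have -> : \sum_(k < stage l y - stage l x) `|p k - l * h| =
  \sum_(k < stage l y - stage l x) `|pl l (stage l x + k)%N - l * h| by [].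
lra.
Qed.

(** The cell containing [u] may begin before [u], where only the bound [M] is known; it adds at most
    [l (M + h)], which vanishes. The other cells lie within [[u, v]], as the cell containing [v] is
    excluded. *)
Lemma uniform_cells_close (u v h e r M : R) : 0 < u -> u < v -> 0 < h -> 0 < e -> 0 < r -> 0 <= M ->
  (forall t, u < t < v -> `|mu t - h| <= e) -> (forall t, u - r < t < v -> mu t <= M) ->
  cells_close u v h (e * (v - u)).
Proof.
move=> u0 uv h0 e0 r0 M0 Hh HM eta eta0.
have S0 : 0 < M + h + e by lra.
exists (Num.min (Num.min r u) (eta / (M + h + e))).
  by rewrite !lt_min r0 u0 divr_gt0.
move=> l /andP[l0]; rewrite !lt_min => /andP[/andP[lr lu]]; rewrite ltr_pdivlMr// => leta.
have /andP[u1 u2] := stageP l0 (ltW u0).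
have /andP[v1 v2] := stageP l0 (ltW (lt_trans u0 uv)).
have suv := stage_le l0 (ltW uv).
have cell0 k : 0 <= l * k%:R by rewrite mulr_ge0// ltW.
have cellS (k : nat) : l * k.+1%:R - l * k%:R = l by rewrite -natr1; ring.
have cle (k : nat) : l * k%:R <= l * k.+1%:R by rewrite ler_pM2l// ler_nat.
have cv k : (k < stage l v - stage l u)%N -> l * (stage l u + k).+1%:R <= v.
  move=> kn; rewrite (le_trans _ v1)// ler_pM2l// ler_nat.
  by rewrite -addnS -(subnKC suv) leq_add2l.
have bnd (k : 'I_(stage l v - stage l u)) : `|pl l (stage l u + k)%N - l * h| <=
    l * e + (if k == 0%N :> nat then l * (M + h) else 0).
  rewrite plE//; have kv := cv _ (ltn_ord k).
  set j := (stage l u + k)%N in kv *.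
  have M1 : mass mu (l * j%:R) (l * j.+1%:R) <= M * l.
    rewrite -{3}(cellS j); apply: le_mass => // t /andP[t1 t2]; apply: HM; apply/andP; split; last by lra.
    have : l * (stage l u)%:R <= l * j%:R by rewrite ler_pM2l// ler_nat leq_addr.
    lra.
  have M2 : 0 <= mass mu (l * j%:R) (l * j.+1%:R) by exact: mass_ge0.
  have lh : 0 < l * h by rewrite mulr_gt0.
  have le' : 0 < l * e by rewrite mulr_gt0.
  have lM : 0 <= M * l by rewrite mulr_ge0// ltW.
  case: eqP => k0.
    rewrite (le_trans (ler_normB _ _))// !ger0_norm ?(ltW lh)//; lra.
  rewrite addr0.
  have uj : u < l * j%:R.
    rewrite (lt_le_trans u2)//.
    rewrite (_ : l * (stage l u)%:R + l = l * (stage l u).+1%:R); last by rewrite -natr1; ring.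
    rewrite ler_pM2l// ler_nat /j -addn1 leq_add2l lt0n; exact/eqP.
  have Hj t : l * j%:R <= t < l * j.+1%:R -> h - e <= mu t <= h + e.
    move=> /andP[t1 t2]; have := Hh t; rewrite ler_norml.
    have ut : u < t < v by apply/andP; split; lra.
    move=> /(_ ut) /andP[? ?]; apply/andP; split; lra.
  have b1 : mass mu (l * j%:R) (l * j.+1%:R) <= (h + e) * l.
    by rewrite -{3}(cellS j); apply: le_mass => // t /Hj/andP[].
  have b2 : (h - e) * l <= mass mu (l * j%:R) (l * j.+1%:R).
    by rewrite -{1}(cellS j); apply: ge_mass => // t /Hj/andP[].
  by rewrite ler_norml; apply/andP; split; lra.
apply: (le_trans (ler_sum _ (fun k _ => bnd k))).
rewrite big_split/= sumr_const card_ord -[_ *+ _]mulr_natr.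
have s2 : \sum_(i < stage l v - stage l u) (if i == 0%N :> nat then l * (M + h) else 0) <= l * (M + h).
  have lM : 0 <= l * (M + h) by rewrite mulr_ge0 ?(ltW l0)//; lra.
  case: (stage l v - stage l u)%N => [|m]; first by rewrite big_ord0.
  by rewrite big_ord_recl/= big1 ?addr0.
have s1 : l * e * (stage l v - stage l u)%:R <= e * (v - u + l).
  rewrite [l * e]mulrC -mulrA ler_pM2l// natrB// mulrBr; lra.
apply: (le_trans (lerD s1 s2)); lra.
Qed.

(** Since [mu] may be unbounded near 0, the triangle inequality replaces any approximation. A small
    [a] and a height [h] with [h a] small make the bound small. *)
Lemma first_cells_close (a h : R) : 0 < a -> 0 < h -> cells_close 0 a h (mass mu 0 a + h * a).
Proof.
move=> a0 h0 eta eta0; exists 1 => // l /andP[l0 _].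
have -> : stage l 0 = 0%N by rewrite /stage mul0r truncn0.
rewrite subn0; under eq_bigr do rewrite add0n.
have /andP[a1 a2] := stageP l0 (ltW a0).
have H : \sum_(k < stage l a) `|pl l k - l * h| <= \sum_(k < stage l a) (pl l k + l * h).
  apply: ler_sum => k _; rewrite (le_trans (ler_normB _ _))//.
  by rewrite !ger0_norm ?pl_ge0// mulr_ge0// ltW.
apply: (le_trans H); rewrite big_split/= sumr_const card_ord -[_ *+ _]mulr_natr.
have -> : \sum_(k < stage l a) pl l k = mass mu 0 (l * (stage l a)%:R).
  have := @mass_sum _ mu muD (fun k => l * k%:R) (stage l a); rewrite mulr0 => ->//.
    by apply: eq_bigr => k _; rewrite plE.
  by move=> i j ij; rewrite ler_pM2l// ler_nat.
have l1 : 0 <= l * (stage l a)%:R by rewrite mulr_ge0// ltW.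
have := massD muD (lexx 0) l1 a1; have := mass_ge0 muD a l1.
have : h * (l * (stage l a)%:R) <= h * a by rewrite ler_pM2l.
lra.
Qed.

(** The bound [2 e (b - x)] is additive over adjacent intervals, which is exactly what the downward
    induction needs, however many steps it takes. *)
Lemma regulated_stage_bound (a e : R) : 0 < a -> a < b -> pw_continuous mu -> 0 < e ->
  stage_bound a (2 * e * (b - a)).
Proof.
move=> a0 ab pw e0.
apply: (@regulated_induction R (fun x => stage_bound x (2 * e * (b - x))) a b (ltW ab)).
  move=> eta eta0; exists 1 => // l _ w; rewrite subnn big_ord0 mul0r subr0 subrr mulr0 add0r.
  rewrite (_ : J _ 0 w = 0) ?normr0 ?ltW//.
  by rewrite -[RHS](V0 w); congr (V _ w); apply/funext => z; rewrite /wsum big_ord0.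
have mu0 t : 0 <= t -> 0 <= mu t by case: muD => + _ _; exact.
move=> x xab; have [x1 x2] : a <= x /\ x <= b by apply/andP.
have [hl [hr [d [[hl0 hr0 d0 da] Hl Hr]]]] := pw_continuous_regulated mu0 pw a0 ab xab e0.
exists d => // u v au uv vb uvx sv.
have u0 : 0 < u by lra.
have D0 : 0 <= e * (v - u) by rewrite mulr_ge0//; lra.
have step h : 0 < h -> cells_close u v h (e * (v - u)) -> stage_bound u (2 * e * (b - u)).
  move=> h0 cc; rewrite (_ : 2 * e * (b - u) = 2 * e * (b - v) + 2 * (e * (v - u))); last by ring.
  by apply: (stage_step (ltW u0) (ltW uv) vb h0 D0 cc).
case: uvx => [[xu vx]|[xu vx]].
- apply: (step hl hl0); apply: (@uniform_cells_close u v hl e (u - (x - d)) (hl + e)) => //; try lra.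
    by move=> t /andP[t1 t2]; apply: Hl; apply/andP; split; lra.
  move=> t /andP[t1 t2].
  have := Hl t; rewrite ler_norml => /(_ _)/andP[|_]; first by apply/andP; split; lra.
  lra.
- have mx : 0 <= mu x by apply: mu0; lra.
  (* The first cell may reach to the left of [x], so [M] has to dominate [mu] on both sides of [x]
     and at [x] itself. *)
  apply: (step hr hr0); apply: (@uniform_cells_close u v hr e d (hl + hr + e + mu x)) => //; try lra.
    by move=> t /andP[t1 t2]; apply: Hr; apply/andP; split; lra.
  move=> t /andP[t1 t2]; have [tx|tx|->] := ltgtP t x; last by lra.
    have := Hl t; rewrite ler_norml => /(_ _)/andP[|_]; first by apply/andP; split; lra.
    lra.
  have := Hr t; rewrite ler_norml => /(_ _)/andP[|_]; first by apply/andP; split; lra.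
  lra.
Qed.

End ScaleLimit.

Lemma cesaro_scale (U : Omega -> R) (HU : forall w, 0 <= U w <= 1) (mu : R -> R) :
  cesaro_bound U -> is_density mu -> pw_continuous mu ->
  forall e : R, 0 < e -> exists2 l0 : R, 0 < l0 & forall l, 0 < l < l0 -> forall w,
    `|V (cost g (scale_dens mu l)) w - U w| <= e.
Proof.
(* The errors sum to at most [9 e1]: [2 e1] from the regulated part, [4 e1] from the cells near 0,
   [e1] of slack, and [e1] each for the truncated cost and the truncated mass. *)
move=> ces muD pw e e0; pose e1 := e / 16; have e10 : 0 < e1 by rewrite /e1; lra.
have [a [b' [a0 ab ma tb]]] := density_exhaust muD e10.
(* Rounding to whole stages loses less than [l < 1], so the last stage boundary still lies beyond
   [b']. *)
pose b := b' + 1; have b0 : 0 < b by rewrite /b; lra.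
have ab1 : a < b by rewrite /b; lra.
have e20 : 0 < e1 / (b - a) by rewrite divr_gt0// subr_gt0.
have := regulated_stage_bound HU ces muD b0 a0 ab1 pw e20.
rewrite (_ : 2 * (e1 / (b - a)) * (b - a) = 2 * e1); last by field; lra.
have h0 : 0 < e1 / a by rewrite divr_gt0.
have ma0 := mass_ge0 muD a (lexx 0).
have cc := first_cells_close muD a0 h0; rewrite divfK ?gt_eqF// in cc.
have D0 : 0 <= mass mu 0 a + e1 by lra.
move=> /(stage_step HU ces muD b0 (lexx 0) (ltW a0) (ltW ab1) h0 D0 cc) => /(_ e1 e10)[l0 l00 Hl].
exists (Num.min l0 1); first by rewrite lt_min l00 ltr01.
move=> l /andP[l1]; rewrite lt_min => /andP[ll0 ll1] w.
have := Hl l (introT andP (conj l1 ll0)) w.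
rewrite mul0r truncn0 subn0; set N := Num.truncn (b / l); set rho := scale_dens mu l.
have rD : is_density rho by exact: scale_density.
under eq_bigr do rewrite add0n.
rewrite (_ : (fun k => cells rho (0 + k)) = cells rho)//.
have tE := tailmass_cells rD N.
have bl0 : 0 <= b / l by rewrite divr_ge0// ltW.
have /andP[N1 N2] : N%:R <= b / l < N.+1%:R by exact: truncn_itv.
have lN : b' <= l * N%:R.
  move: N2; rewrite -natr1 ltr_pdivrMr// mulrDl mul1r mulrC /b; lra.
have b'0 : 0 <= b' by lra.
have t1 : tailmass rho N%:R <= e1.
  have E1 := mass_tail rD (ler0n R N); rewrite mass_scale// mulr0 in E1.
  have lN0 : 0 <= l * N%:R by lra.
  have E2 := mass_tail muD lN0.
  have E3 := tailmassD muD b'0 lN; have := mass_ge0 muD (l * N%:R) b'0; lra.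
have t0 := tailmass_ge0 rD (ler0n R N).
have d1 : `|V (cost g rho) w - J (cells rho) N w| <= e1.
  apply: V_dist; first exact: bounded_on_cost.
  by move=> z Kz; exact: le_trans (cost_dist rD N Kz) t1.
have d2 : `|(1 - \sum_(k < N) cells rho k) * U w| <= e1.
  have /andP[U0 U1] := HU w; rewrite -tE normrM !ger0_norm//.
  by rewrite (le_trans _ t1)// ler_piMr.
move=> d3.
have -> : V (cost g rho) w - U w = (V (cost g rho) w - J (cells rho) N w) +
  ((J (cells rho) N w - (\sum_(k < N) cells rho k) * U w) - (1 - \sum_(k < N) cells rho k) * U w) by ring.
rewrite (le_trans (ler_normD _ _))//.
have := ler_normB (J (cells rho) N w - (\sum_(k < N) cells rho k) * U w) ((1 - \sum_(k < N) cells rho k) * U w).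
rewrite /e1 in e10 ma d1 d2 d3 *; lra.
Qed.

Lemma V_cost_unifd (n : nat) w : (0 < n)%N ->
  V (cost g (unifd n%:R)) w = n%:R^-1 * J (fun=> 1) n w.
Proof.
move=> n0; have nr0 : 0 < n%:R :> R by rewrite ltr0n.
have D := unifd_density nr0.
have cE k : (k < n)%N -> cells (unifd n%:R) k = n%:R^-1.
  move=> kn; have k1 : k%:R <= k.+1%:R :> R by rewrite ler_nat.
  have kd : k.+1%:R - k%:R = 1 :> R by rewrite -natr1 addrAC subrr add0r.
  have uE t : k%:R <= t < k.+1%:R -> unifd n%:R t = n%:R^-1.
    move=> /andP[t1 t2]; rewrite /unifd (le_trans _ t1)//= (le_trans (ltW t2))//.
    by rewrite ler_nat.
  have E : n%:R^-1 * (k.+1%:R - k%:R) = n%:R^-1 :> R by rewrite kd mulr1.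
  rewrite -[RHS]E; apply/le_anti/andP; split.
    by apply: le_mass => // t /uE->.
  by apply: ge_mass => // t /uE->.
have t0 : tailmass (unifd n%:R) n%:R = 0 :> R.
  rewrite tailmass_cells//; under eq_bigr do rewrite cE//.
  by rewrite sumr_const card_ord -[_ *+ _]mulr_natr mulVf ?subrr// gt_eqF.
rewrite /J -VZ; last 2 first.
- exact: bounded_on_wsum.
- by rewrite invr_ge0 ltW.
congr (_ w); apply: eq_V; first exact: bounded_on_cost.
move=> z Kz; have := cost_dist D n Kz; rewrite t0 normr_le0 subr_eq0 => /eqP->.
by rewrite -wsumZ; apply: eq_bigr => k _; rewrite cE// mulr1.
Qed.

(** * Uniform limits and limits over scalings *)

Section Limits.
Variable U : Omega -> R.
Hypothesis HU : forall w, 0 <= U w <= 1.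

Definition unif_limit := forall e : R, 0 < e -> exists N0 : nat, forall n : nat, (N0 <= n)%N ->
  forall w, `|V (cost g (unifd n%:R)) w - U w| <= e.

Definition scale_limit (mu : R -> R) := forall e : R, 0 < e -> exists2 l0 : R, 0 < l0 &
  forall l, 0 < l < l0 -> forall w, `|V (cost g (scale_dens mu l)) w - U w| <= e.

Let unif_dist (n : nat) w : (0 < n)%N ->
  `|V (cost g (unifd n%:R)) w - U w| = n%:R^-1 * `|J (fun=> 1) n w - n%:R * U w|.
Proof.
move=> n0; have nr0 : 0 < n%:R :> R by rewrite ltr0n.
rewrite V_cost_unifd// -[X in X * `|_|]gtr0_norm ?invr_gt0// -normrM; congr `|_|.
by field; rewrite gt_eqF.
Qed.

(** Below the threshold [N0] the value and [n U] are each at most [n] in absolute value, whence the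
    constant [2 N0]. *)
Lemma unif_limit_cesaro : unif_limit -> cesaro_bound U.
Proof.
move=> ul e e0; have [N0 HN] := ul e e0; exists (2 * N0%:R) => // n w.
have [->|n0] := posnP n.
  rewrite mul0r subr0 mulr0 add0r (le_trans (J_le _ _ _))// big_ord0 mulr_ge0//.
have [nN|nN] := leqP N0 n.
  have := HN n nN w; rewrite unif_dist// ler_pdivrMl ?ltr0n// => H.
  by rewrite (le_trans H)// mulrC lerDl mulr_ge0.
have nN' : n%:R <= N0%:R :> R by rewrite ler_nat ltnW.
have J1 : `|J (fun=> 1) n w| <= n%:R.
  rewrite (le_trans (J_le _ _ _))//.
  by under eq_bigr do rewrite normr1; rewrite sumr_const card_ord.
have /andP[U0 U1] := HU w.
have nU : `|n%:R * U w| <= n%:R by rewrite ger0_norm ?mulr_ge0// ler_piMr.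
rewrite (le_trans (ler_normB _ _))//.
have : 0 <= e * n%:R by rewrite mulr_ge0// ltW.
lra.
Qed.

Lemma selfsimilar_unif_limit (f : R -> R) (f0 L : R) : is_density f -> 0 < f0 -> 0 <= L ->
  (forall t, 0 <= t -> f t <= f0) -> (forall t, 0 <= t -> f0 * (1 - L * t) <= f t) ->
  (forall r, 0 <= r -> exists s c : R, [/\ 0 < s <= 1, 0 < c &
     forall t, 0 <= t -> f (r + t) = c * f (s * t)]) ->
  scale_limit f -> unif_limit.
Proof.
move=> fD f00 L0 fle fge fss sl e e0.
have sb := selfsimilar_small_blocks HU fD f00 L0 fle fge fss sl.
have D0 : 0 <= 2 * (L / f0) + 4 by have : 0 <= L / f0 by [rewrite divr_ge0// ltW]; lra.
have [N0 HN] := small_blocks_cesaro HU D0 sb e0.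
exists (maxn N0 1) => n; rewrite geq_max => /andP[nN n0] w.
by rewrite unif_dist// ler_pdivrMl ?ltr0n// [n%:R * e]mulrC HN.
Qed.

Lemma unif_limit_scale (mu : R -> R) : unif_limit -> is_density mu -> pw_continuous mu ->
  scale_limit mu.
Proof. by move=> /unif_limit_cesaro; exact: cesaro_scale. Qed.

End Limits.

End Game.

(** * Equivalence of the five conditions with convergence along integer horizons *)

Theorem theorem2 (R : realType) (Omega : Type) (K : set (R -> Omega))
  (g : Omega -> R) (V : ((R -> Omega) -> R) -> Omega -> R) (Ustar : Omega -> R)
  (HK0 : K !=set0)
  (HKneg : forall z, K z -> forall t : R, t < 0 -> z t = z 0)
  (Hg : forall w, 0 <= g w <= 1)
  (Hgm : forall z, K z -> lmeas Rp (fun t => g (z t)))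
  (HV : game_mapping K V)
  (HDPP : discrete_DPP g V)
  (HU : forall w, 0 <= Ustar w <= 1)
  (Hper : forall z, K z -> forall (n : nat) (s : R), 0 < s < 1 ->
            z (n%:R + s) = z n%:R) :
  let VV := fun rho : R -> R => V (cost g rho) in
  let u' := (fun n : nat => dev (VV (unifd n%:R)) Ustar) @ \oo --> 0%E in
  [/\ (forall mu : R -> R, is_density mu -> pw_continuous mu ->
         dev (VV (scale_dens mu lam)) Ustar @[lam --> at_right (0:R)] --> 0%E) <-> u',
      (dev (VV (unifd T)) Ustar @[T --> +oo] --> 0%E) <-> u',
      (dev (VV (expd lam)) Ustar @[lam --> at_right (0:R)] --> 0%E) <-> u',
      (exists rho : R -> R, power_density rho /\
         (dev (VV (shift_dens rho T)) Ustar @[T --> +oo] --> 0%E)) <-> u'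
    & (forall rho : R -> R, power_density rho ->
         dev (VV (shift_dens rho T)) Ustar @[T --> +oo] --> 0%E) <-> u'].
Proof.
move=> VV u'.
have [z0 _] := HK0; have w0 := z0 0.
have uP : u' <-> unif_limit g V Ustar.
  rewrite /u' (@dev_cvg0P R Omega w0); split => H e e0; have := H e e0.
    by move=> [N _ HN]; exists N => n nN; exact: HN.
  by move=> [N HN]; exists N.
have sP mu : dev (VV (scale_dens mu lam)) Ustar @[lam --> at_right (0:R)] --> 0%E <->
    scale_limit g V Ustar mu.
  rewrite (@dev_cvg0P R Omega w0).
  by split => H e e0; apply/near_right0P; exact: H.
have u's mu : is_density mu -> pw_continuous mu -> u' -> scale_limit g V Ustar mu.
  by move=> D pw /uP ul; apply: (@unif_limit_scale R Omega K g V).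
have eP : dev (VV (expd lam)) Ustar @[lam --> at_right (0:R)] --> 0%E <->
    scale_limit g V Ustar (expd 1).
  rewrite -sP (_ : (fun lam => dev (VV (expd lam)) Ustar) =
    (fun lam => dev (VV (scale_dens (expd 1) lam)) Ustar))//.
  by apply/funext => l; rewrite expdE.
have uu' : dev (VV (unifd T)) Ustar @[T --> +oo] --> 0%E -> u'.
  rewrite (@dev_cvg0P R Omega w0) uP => H e e0.
  have /near_pinftyP[M HM] := H e e0.
  exists (Num.truncn M).+1 => n nM; apply: HM.
  by rewrite (lt_le_trans (truncnS_gt _))// ler_nat.
(* Every [unifd T] is the scaling of [unifd 1] by [1 / T], so real horizons are covered by one
   piecewise continuous density. *)
have su : scale_limit g V Ustar (unifd 1) -> dev (VV (unifd T)) Ustar @[T --> +oo] --> 0%E.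
  move=> sl; rewrite (@dev_cvg0P R Omega w0) => e /sl[l0 l00 Hl]; apply/near_pinftyP.
  exists l0^-1 => T lT; have T0 : 0 < T by rewrite (lt_trans _ lT)// invr_gt0.
  by rewrite /VV unifdE//; apply: Hl; rewrite invr_gt0 T0/= invf_plt.
have ps rho : power_density rho -> scale_limit g V Ustar rho ->
    dev (VV (shift_dens rho T)) Ustar @[T --> +oo] --> 0%E.
  move=> pd sl; have [f0 [k [c [f00 k0 c0 rE]]]] := power_densityE pd.
  rewrite (@dev_cvg0P R Omega w0) => e /sl[l0 l00 Hl]; apply/near_pinftyP.
  exists (l0^-1 / k) => T lT.
  have T0 : 0 < T by rewrite (lt_trans _ lT)// divr_gt0// invr_gt0.
  have kT : l0^-1 < k * T by rewrite mulrC -ltr_pdivrMr.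
  have k1 : 0 < 1 + k * T by rewrite addr_gt0// mulr_gt0.
  rewrite /VV (eq_cost_fun g (power_shift k0 rE pd.1 (ltW T0))).
  by apply: Hl; rewrite invr_gt0 k1/= invf_plt// (lt_trans kT)// ltrDr.
have sp rho : power_density rho -> dev (VV (shift_dens rho T)) Ustar @[T --> +oo] --> 0%E -> u'.
  move=> pd; have [f0 [k [c [f00 k0 c0 rE]]]] := power_densityE pd.
  rewrite (@dev_cvg0P R Omega w0) uP => sl.
  apply: (@selfsimilar_unif_limit R Omega K g V Hg Hgm HV HDPP Hper Ustar HU rho f0 (c * k)) => //.
  - exact: pd.1.
  - by rewrite mulr_ge0// ltW.
  - exact: power_le rE.
  - exact: power_ge rE.
  - exact: power_selfsimilar_ex rE.
  move=> e /sl/near_pinftyP[M HM].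
  have Mk : 0 < 1 + k * `|M| by rewrite ltr_pwDl// mulr_ge0// ltW.
  exists (1 + k * `|M|)^-1; first by rewrite invr_gt0.
  (* Solving [1 + k T = 1 / l] for [T] presents the scaling by [l] as a shift. *)
  move=> l /andP[l0 lM] w; pose T := (l^-1 - 1) / k.
  have lE : 1 + k * T = l^-1 by rewrite /T mulrC divfK ?gt_eqF//; ring.
  have MT : `|M| < T.
    by rewrite /T ltr_pdivlMr// ltrBrDl mulrC -invf_pgt ?posrE.
  have T0 : 0 <= T by rewrite (le_trans _ (ltW MT)).
  have := HM T (le_lt_trans (ler_norm M) MT) w.
  by rewrite /VV (eq_cost_fun g (power_shift k0 rE pd.1 T0)) lE invrK.
have pw rho : power_density rho -> pw_continuous rho.
  by move=> /power_densityE[f0 [k [c [f00 k0 c0 rE]]]]; exact: power_pw_continuous rE.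
split; split => //.
- by move=> H; apply: uu'; apply: su; apply/sP; exact: (H _ (@unifd1_density R) (@unifd1_pw_continuous R)).
- by move=> Hu mu D mupw; apply/sP; exact: u's.
- by move=> Hu; apply: su; apply: u's => //; [exact: unifd1_density|exact: unifd1_pw_continuous].
- move=> /eP sl; apply/uP.
  apply: (@selfsimilar_unif_limit R Omega K g V Hg Hgm HV HDPP Hper Ustar HU (expd 1) 1 1) => //.
  + exact: expd1_density.
  + by move=> t t0; rewrite /expd mul1r -[leRHS]expR0 ler_expR mul1r oppr_le0.
  + by move=> t t0; rewrite /expd !mul1r; exact: expR_ge1Dx.
  + exact: expd1_selfsimilar.
- move=> Hu; apply/eP; apply: u's => //; [exact: expd1_density|exact: expd1_pw_continuous].
- by move=> [rho [pd H]]; exact: sp pd H.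
- move=> Hu; have [rho pd] := power_density_ex R; exists rho; split => //.
  by apply: ps => //; apply: u's => //; [exact: pd.1|exact: pw].
- by move=> H; have [rho pd] := power_density_ex R; exact: sp pd (H rho pd).
- by move=> Hu rho pd; apply: ps => //; apply: u's => //; [exact: pd.1|exact: pw].
Qed.
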